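(* Let $\mathbb{X}=\{\mathbf{x}_1,\dots,\mathbf{x}_N\}\subset\mathbb{R}^d$, let $P$ be a probability measure supported on the $N$ points of $\mathbb{X}$, let $Q$ be a probability measure on $\mathbb{R}^d$ with $\int|\mathbf{y}|^2dQ(\mathbf{y})<\infty$, and let $Q_m$ be the empirical measure of an i.i.d. sample $Y_1,\dots,Y_m$ from $Q$. Then $$E\left|\mathcal{W}_1(P,Q_m)-\mathcal{W}_1(P,Q)\right|\leq\frac{8\sqrt{2N}}{\sqrt{m}}K(\mathbb{X},Q),$$ where $K(\mathbb{X},Q)=\left(4\operatorname{diam}(\mathbb{X})+2\sqrt{\int|\mathbf{y}|^2dQ(\mathbf{y})}+2\operatorname{diam}(\mathbb{X})\right)\left(\log 2+\sqrt{2\operatorname{diam}(\mathbb{X})+1}\right)$.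
   Context: $|\cdot|$ is the Euclidean norm and $\mathcal{W}_1(\mu,\nu)=\inf_{\pi\in\Pi(\mu,\nu)}\int|\mathbf{x}-\mathbf{y}|\,d\pi(\mathbf{x},\mathbf{y})$ over couplings $\pi$ of $\mu,\nu$. $\operatorname{diam}(\mathbb{X})=\max_{i,j}|\mathbf{x}_i-\mathbf{x}_j|$. *)

(* Defs.v *)
From HB Require Import structures.
From mathcomp Require Import all_boot all_order all_algebra.
From mathcomp Require Import all_classical all_reals all_analysis.
Set Implicit Arguments. Unset Strict Implicit. Unset Printing Implicit Defensive.
Import Order.TTheory GRing.Theory Num.Theory.
Import numFieldNormedType.Exports.
Local Open Scope classical_set_scope.
Local Open Scope ring_scope.

Definition Rd (R : realType) (d : nat) :=
  g_sigma_algebraType (@open 'rV[R]_d).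

(* Euclidean norm |v| (NOT mathcomp's max-norm `|v|). *)
Definition enorm (R : realType) (d : nat) (v : 'rV[R]_d) : R :=
  Num.sqrt (\sum_(i < d) (v ord0 i) ^+ 2).

Definition diam (R : realType) (d N : nat) (x : 'I_N -> 'rV[R]_d) : R :=
  \big[Num.max/0]_(i < N) \big[Num.max/0]_(j < N) enorm (x i - x j).

Definition coupling (R : realType) (d : nat) (mu nu : set (Rd R d) -> \bar R)
  (pi : probability (Rd R d * Rd R d)%type R) : Prop :=
  forall A : set (Rd R d), measurable A ->
    pi (fst @^-1` A) = mu A /\ pi (snd @^-1` A) = nu A.

Definition W1 (R : realType) (d : nat) (mu nu : set (Rd R d) -> \bar R) : \bar R :=
  ereal_inf [set (\int[pi]_z (enorm (z.1 - z.2 : 'rV[R]_d))%:E)%E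
            | pi in [set pi | coupling mu nu pi]].

Definition empirical (R : realType) (d m : nat) (y : 'I_m -> Rd R d)
  : set (Rd R d) -> \bar R :=
  fun A => ((m%:R^-1)%:E * \sum_(k < m) \d_(y k) A)%E.

Definition iid_sample (R : realType) (d m : nat) (dO : measure_display)
  (Omega : measurableType dO) (Pr : probability Omega R)
  (Q : probability (Rd R d) R) (Y : 'I_m -> Omega -> Rd R d) : Prop :=
  (forall k, measurable_fun setT (Y k)) /\
  (forall k (A : set (Rd R d)), measurable A -> Pr (Y k @^-1` A) = Q A) /\
  (forall B : 'I_m -> set (Rd R d), (forall k, measurable (B k)) ->
     Pr (\bigcap_(k in [set: 'I_m]) (Y k @^-1` B k)) =
     (\prod_(k < m) Pr (Y k @^-1` B k))%E).

(* Main.v *)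
Require Import Defs.
From HB Require Import structures.
From mathcomp Require Import all_boot all_order all_algebra.
From mathcomp Require Import all_classical all_reals all_analysis.
From mathcomp Require Import ring lra measurable_realfun giry.
Set Implicit Arguments. Unset Strict Implicit. Unset Printing Implicit Defensive.
Import Order.TTheory GRing.Theory Num.Theory.
Import numFieldNormedType.Exports.
Local Open Scope classical_set_scope.
Local Open Scope ring_scope.

(** Write [P] as the sum of the [p_i \delta_(x_i)] with [p_i > 0]. For every
  [e > 0] there are potentials [h_i >= 0], a function [G] with
  [G y <= |x_i - y| + h_i], and weights [w_i(y)] summing to [1], all independent
  of the sample, such that, with [c = \sum_i w_i |x_i - .|] and up to [O(e)],
  [\int w_i dQ = p_i] and [\int c dQ <= \int G dQ - \sum_i p_i h_i]. They come
  from a near-minimiser of the entropic dual functional: [G] is a soft minimum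
  and the [w_i] are the corresponding Gibbs weights. For any probability [nu],
  weak duality gives [\int G dnu - \sum_i p_i h_i <= W1(P, nu)], while moving
  mass between the atoms, at distance at most [D = diam X] from each other,
  gives [W1(P, nu) <= \int c dnu + D \sum_i |\int w_i dnu - p_i|]. Applied to
  [Q] and to [Q_m], these bounds show that [|W1(P, Q_m) - W1(P, Q)|] is at most,
  up to [O(e)], the sum of the deviations of the empirical means of the fixed
  functions [c] and [G], plus [D] times those of the [w_i]. These have mean
  [O(1 / sqrt m)] by orthogonality, so neither symmetrisation nor chaining is
  needed; the factor [sqrt N] comes from [\sum_i \int w_i dQ = 1]. *)

(** Weights of total mass one force the index type to be inhabited; the extracted index serves later
    as a base point. *)
Lemma sum1_ord {R : nzRingType} n (p : 'I_n -> R) : \sum_i p i = 1 -> 'I_n.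
Proof.
case: n p => [p|n _ _]; last exact: ord0.
by rewrite big_ord0 => /esym/eqP; rewrite oner_eq0.
Qed.

(** * The Euclidean norm *)

Section euclidean_norm.
Context {R : realType} {d : nat}.
Implicit Types u v : 'rV[R]_d.

Lemma enorm_ge0 u : 0 <= enorm u.
Proof. exact: sqrtr_ge0. Qed.

Lemma enorm_sqr u : enorm u ^+ 2 = \sum_(i < d) u ord0 i ^+ 2.
Proof. by rewrite sqr_sqrtr// sumr_ge0// => i _; rewrite sqr_ge0. Qed.

Lemma enormN u : enorm (- u) = enorm u.
Proof. by congr Num.sqrt; apply: eq_bigr => i _; rewrite mxE sqrrN. Qed.

Lemma enorm_eq0 u : enorm u = 0 -> u = 0.
Proof.
move=> u0; have : \sum_(i < d) u ord0 i ^+ 2 == 0 by rewrite -enorm_sqr u0 expr0n.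
rewrite psumr_eq0; last by move=> i _; rewrite sqr_ge0.
move=> /allP u0'; apply/rowP => i; rewrite mxE.
by apply/eqP; have := u0' i (mem_index_enum _); rewrite /= sqrf_eq0.
Qed.

Lemma enorm_cauchy_schwarz u v :
  \sum_(i < d) u ord0 i * v ord0 i <= enorm u * enorm v.
Proof.
have [/enorm_eq0 u0|u0] := eqVneq (enorm u) 0.
  by rewrite big1 ?mulr_ge0 ?enorm_ge0// => i _; rewrite u0 mxE mul0r.
have [/enorm_eq0 v0|v0] := eqVneq (enorm v) 0.
  by rewrite big1 ?mulr_ge0 ?enorm_ge0// => i _; rewrite v0 mxE mulr0.
have uv0 : 0 < enorm u * enorm v by rewrite mulr_gt0// lt0r enorm_ge0 ?u0 ?v0.
(* Expanding the squares turns this into [2 |u| |v| (|u| |v| - <u, v>) >= 0], where the factor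
   [|u| |v|] is positive. *)
have : 0 <= \sum_(i < d) (enorm v * u ord0 i - enorm u * v ord0 i) ^+ 2.
  by apply: sumr_ge0 => i _; rewrite sqr_ge0.
under eq_bigr do rewrite sqrrB !exprMn.
rewrite big_split sumrB/= -!mulr_sumr -!enorm_sqr sumrMnl.
rewrite (eq_bigr (fun i => enorm v * enorm u * (u ord0 i * v ord0 i))); last first.
  by move=> i _; rewrite mulrACA.
rewrite -mulr_sumr => H; rewrite -(ler_pM2l uv0); nra.
Qed.

Lemma enormD u v : enorm (u + v) <= enorm u + enorm v.
Proof.
rewrite -(ler_pXn2r (_ : 0 < 2)%N) ?nnegrE ?addr_ge0 ?enorm_ge0//.
rewrite enorm_sqr; under eq_bigr do rewrite mxE sqrrD.
rewrite !big_split/= -!enorm_sqr.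
have := enorm_cauchy_schwarz u v; nra.
Qed.

Lemma enormB_triangle w u v : enorm (u - v) <= enorm (u - w) + enorm (w - v).
Proof. by rewrite (le_trans _ (enormD _ _))// addrA subrK. Qed.

Lemma enormBC u v : enorm (u - v) = enorm (v - u).
Proof. by rewrite -enormN opprB. Qed.

End euclidean_norm.

(** * Borel measurability of the Euclidean norm *)

Section euclidean_measurability.
Context {R : realType} {d : nat}.

Lemma measurable_coord (i : 'I_d) :
  measurable_fun [set: Rd R d] (fun v : Rd R d => (v : 'rV[R]_d) ord0 i).
Proof.
apply: (measurability _ (RGenOpens.measurableE R)).
move=> _ [_ [a [b ->]] <-]; rewrite setTI.
apply: sub_sigma_algebra.
apply: open_comp; last exact: interval_open.
by move=> v _; exact: coord_continuous.
Qed.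

Lemma measurable_set1_Rd (v : Rd R d) : measurable [set v].
Proof.
rewrite -[X in measurable X]setCK; apply: measurableC.
apply: sub_sigma_algebra; rewrite openC.
apply: compact_closed; first exact: norm_hausdorff.
exact: compact_set1.
Qed.

Lemma measurable_sqrt : measurable_fun [set: R] (@Num.sqrt R).
Proof. by apply: continuous_measurable_fun; exact: sqrt_continuous. Qed.

(** The difference is treated coordinate by coordinate, because the sigma-algebra on pairs is
    generated by rectangles rather than by open sets. *)
Lemma measurable_fun_enormB d' (T : measurableType d') (f g : T -> Rd R d) :
  measurable_fun setT f -> measurable_fun setT g ->
  measurable_fun setT (fun t => enorm (f t - g t : 'rV[R]_d)).
Proof.
move=> mf mg; apply: measurableT_comp; first exact: measurable_sqrt.
apply: measurable_sum => i.
apply: measurable_funX.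
rewrite [X in measurable_fun _ X](_ : _ =
   (fun t => (f t : 'rV[R]_d) ord0 i - (g t : 'rV[R]_d) ord0 i)); last first.
  by apply/funext => t; rewrite !mxE.
apply: measurable_funB.
- exact: measurableT_comp (measurable_coord i) mf.
- exact: measurableT_comp (measurable_coord i) mg.
Qed.

Lemma measurable_enorm : measurable_fun setT (fun v : Rd R d => enorm (v : 'rV[R]_d)).
Proof.
have := @measurable_fun_enormB _ _ id (cst 0) (@measurable_id _ _ _)
  (@measurable_cst _ _ _ _ _ _).
by under eq_fun do rewrite /= subr0.
Qed.

End euclidean_measurability.

(** * Mixtures *)

(** Normalising a measure of mass one leaves its values unchanged and supplies the probability
    structure; [\d_point] is only the fallback of [mnormalize] for a degenerate mass. *)
Lemma probability_of_measure {R : realType} d (T : measurableType d)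
    (m : {measure set T -> \bar R}) : m [set: T] = 1%E ->
  exists mu : probability T R, forall A, mu A = m A.
Proof.
move=> m1; exists (mnormalize m \d_point).
by move=> A; rewrite /= /mnormalize m1 onee_eq0/= invr1 mule1.
Qed.

Section dirac_mixture.
Context {R : realType} d (T : measurableType d) {n : nat}.
Variables (w : 'I_n -> R) (z : 'I_n -> T).
Hypothesis w_ge0 : forall i, 0 <= w i.
Hypothesis w_sum1 : \sum_i w i = 1.

(** [msum] reads a family indexed by [nat], so indices from [n] on receive the zero measure. *)
Let comp (k : nat) : {measure set T -> \bar R} :=
  if insub k is Some i then mscale (NngNum (w_ge0 i)) \d_(z i) else mzero.

Lemma dirac_mixture_ex : exists mu : probability T R,
  (forall A, mu A = \sum_i (w i)%:E * \d_(z i) A)%E /\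
  (forall f : T -> \bar R, measurable_fun setT f -> (forall t, 0 <= f t)%E ->
    (\int[mu]_t f t = \sum_i (w i)%:E * f (z i))%E).
Proof.
have mE A : (msum comp n A = \sum_i (w i)%:E * \d_(z i) A)%E.
  by apply: eq_bigr => i _; rewrite /comp valK.
have m1 : msum comp n [set: T] = 1%E.
  rewrite mE; under eq_bigr do rewrite diracT mule1.
  by rewrite sumEFin w_sum1.
have [mu muE] := probability_of_measure m1.
exists mu; split => [A|f mf f0]; first by rewrite muE; exact: mE.
rewrite (eq_measure_integral (msum comp n)); last by move=> A _ _; exact: muE.
rewrite [LHS]ge0_integral_measure_sum//.
apply: eq_bigr => i _; rewrite /comp valK.
by rewrite ge0_integral_mscale// integral_dirac// diracT mul1e.
Qed.

End dirac_mixture.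

Section mixture_coupling.
Context {R : realType} d1 d2 (T : measurableType d1) (Z : measurableType d2).
Context {n : nat}.
Variables (nu : probability T R) (w : 'I_n -> T -> R) (phi : 'I_n -> T -> Z).
Hypothesis w_meas : forall i, measurable_fun setT (w i).
Hypothesis phi_meas : forall i, measurable_fun setT (phi i).
Hypothesis w_ge0 : forall i t, 0 <= w i t.
Hypothesis w_sum1 : forall t, \sum_i w i t = 1.

(** This is the law of [phi I t] when [t] has law [nu] and, given [t], the index [I] is drawn with
    probabilities [w i t]. It is the Giry bind of [nu] with the kernel of Dirac mixtures. *)
Lemma mixture_ex : exists mu : probability Z R,
  forall f : Z -> \bar R, measurable_fun setT f -> (forall z, 0 <= f z)%E ->
    (\int[mu]_z f z = \int[nu]_t (\sum_i (w i t)%:E * f (phi i t)))%E.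
Proof.
have kerP t := @dirac_mixture_ex R d2 Z n (w ^~ t) (phi ^~ t) (w_ge0 ^~ t) (w_sum1 t).
pose k t : giry Z R := projT1 (cid (kerP t)).
have kE t A : (k t A = \sum_i (w i t)%:E * \d_(phi i t) A)%E.
  rewrite /k; case: (cid (kerP t)) => mu [H _] /=; exact: H.
have kI t f : measurable_fun setT f -> (forall z, 0 <= f z)%E ->
    (\int[k t]_z f z = \sum_i (w i t)%:E * f (phi i t))%E.
  move=> mf f0; rewrite /k; case: (cid (kerP t)) => mu [_ H] /=; exact: H.
(* Measurability into the space of measures reduces to that of the evaluations at each measurable
   set. *)
have mk : measurable_fun setT k.
  apply: measurable_giry_codensity => // B mB.
  under eq_fun do rewrite kE.
  apply: emeasurable_sum => i; apply: emeasurable_funM.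
    exact/measurable_EFinP.
  exact: measurableT_comp (measurable_fun_dirac _) _.
pose m : subprobability Z R := giry_bind (nu : giry T R) mk.
have mI f : measurable_fun setT f -> (forall z, 0 <= f z)%E ->
    (\int[m]_z f z = \int[nu]_t (\sum_i (w i t)%:E * f (phi i t)))%E.
  move=> mf f0; rewrite [LHS]giry_int_bind//.
  by apply: eq_integral => t _; exact: kI.
(* The bind is only a subprobability; its mass is found by integrating the constant 1. *)
have m1 : m [set: Z] = 1%E.
  rewrite -[LHS]mul1e -integral_cst// mI//.
  under eq_integral.
    move=> t _; under eq_bigr do rewrite mule1.
    rewrite sumEFin w_sum1; over.
  by rewrite integral_cst// mul1e; exact: (probability_setT nu).
have [mu muE] := probability_of_measure m1.
by exists mu => f mf f0; rewrite -mI//; apply: eq_measure_integral => A _ _; exact: muE.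
Qed.

End mixture_coupling.

(** * Entropic duality *)

Section Rintegral_probability.
Context {R : realType} d (T : measurableType d) (Q : probability T R).
Implicit Types f g : T -> R.

Lemma Rintegrable_dominated f g : measurable_fun setT f ->
  Q.-integrable setT (EFin \o g) -> (forall t, `|f t| <= g t) ->
  Q.-integrable setT (EFin \o f).
Proof.
move=> mf ig fg; apply: (le_integrable _ _ _ ig) => //; first exact/measurable_EFinP.
by move=> t _ /=; rewrite lee_fin (le_trans (fg t))// ler_norm.
Qed.

Lemma Rintegrable_cst r : Q.-integrable setT (EFin \o (fun=> r)).
Proof. exact: finite_measure_integrable_cst. Qed.

Lemma Rintegrable_bounded f r : measurable_fun setT f ->
  (forall t, `|f t| <= r) -> Q.-integrable setT (EFin \o f).
Proof. by move=> mf; apply: Rintegrable_dominated => //; exact: Rintegrable_cst. Qed.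

Lemma RintegrableD f g : Q.-integrable setT (EFin \o f) ->
  Q.-integrable setT (EFin \o g) ->
  Q.-integrable setT (EFin \o (fun t => f t + g t)).
Proof.
move=> iF ig; have := integrableD measurableT iF ig.
by apply: eq_integrable => // t _.
Qed.

Lemma RintegrableB f g : Q.-integrable setT (EFin \o f) ->
  Q.-integrable setT (EFin \o g) ->
  Q.-integrable setT (EFin \o (fun t => f t - g t)).
Proof.
move=> iF ig; have := integrableB measurableT iF ig.
by apply: eq_integrable => // t _.
Qed.

Lemma RintegrableZl r f : Q.-integrable setT (EFin \o f) ->
  Q.-integrable setT (EFin \o (fun t => r * f t)).
Proof.
move=> iF; have := integrableZl measurableT r iF.
by apply: eq_integrable => // t _.
Qed.

Lemma Rintegrable_sum n (F : 'I_n -> T -> R) :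
  (forall i, Q.-integrable setT (EFin \o F i)) ->
  Q.-integrable setT (EFin \o (fun t => \sum_i F i t)).
Proof.
move=> iF; have := @integrable_sum _ _ _ Q setT measurableT _ (index_enum 'I_n)
  xpredT (fun i => EFin \o F i) (fun i _ => iF i).
by apply: eq_integrable => // t _; rewrite /= sumEFin.
Qed.

Lemma Rintegral_cst1 r : \int[Q]_t r = r :> R.
Proof.
rewrite Rintegral_cst// -[RHS]mulr1; congr (_ * _).
by rewrite -[RHS]/(fine 1%E) -(probability_setT Q).
Qed.

Lemma Rintegral_sum n (F : 'I_n -> T -> R) :
  (forall i, Q.-integrable setT (EFin \o F i)) ->
  \int[Q]_t (\sum_i F i t) = \sum_i \int[Q]_t F i t :> R.
Proof.
elim: n F => [|n ih] F iF.
  by rewrite big_ord0; under eq_Rintegral do rewrite big_ord0; exact: Rintegral_cst1.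
under eq_Rintegral do rewrite big_ord_recr/=.
rewrite RintegralD//; last exact: Rintegrable_sum.
by rewrite big_ord_recr/= ih.
Qed.

End Rintegral_probability.

(** * Soft minima, Gibbs weights and the entropic dual functional *)

Section softmin.
Context {R : realType} d (T : measurableType d) (Q : probability T R).
Context {n : nat}.
Variables (i0 : 'I_n) (p : 'I_n -> R) (k : 'I_n -> T -> R).
Hypothesis p_gt0 : forall i, 0 < p i.
Hypothesis p_sum1 : \sum_i p i = 1.
Hypothesis k_meas : forall i, measurable_fun setT (k i).
Hypothesis k_ge0 : forall i t, 0 <= k i t.
Hypothesis k_int : forall i, Q.-integrable setT (EFin \o k i).
Implicit Types u : 'I_n -> R.

(** Here [u] and [k] stand for a dual potential and a cost divided by the temperature, so that minus
    the logarithm of this sum is the soft minimum of the [k i - u i]. *)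
Definition partition_fun u t := \sum_i expR (u i - k i t).
Definition gibbs u i t := expR (u i - k i t) / partition_fun u t.
(** Up to scaling, the negated semi-discrete entropic dual objective. It is convex in [u] with
    partial derivatives [\int w_i dQ - p_i], so at a minimiser the Gibbs weights have marginals
    [p]. *)
Definition entropic_loss u := \int[Q]_t (ln (partition_fun u t)) - \sum_i p i * u i.

Local Notation S := partition_fun.
Local Notation w := gibbs.
Local Notation Psi := entropic_loss.

Lemma partition_fun_gt0 u t : 0 < S u t.
Proof.
rewrite /S (bigD1 i0)//= ltr_pwDl ?expR_gt0// sumr_ge0//.
Qed.
Local Hint Resolve partition_fun_gt0 : core.

Lemma gibbs_gt0 u i t : 0 < w u i t.
Proof. by rewrite divr_gt0// expR_gt0. Qed.

Lemma gibbs_sum1 u t : \sum_i w u i t = 1.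
Proof. by rewrite -mulr_suml -/(S u t) divff// gt_eqF. Qed.

Lemma gibbs_le1 u i t : w u i t <= 1.
Proof.
rewrite -(gibbs_sum1 u t) (bigD1 i)//= lerDl sumr_ge0// => j _.
exact/ltW/gibbs_gt0.
Qed.

(** The purely exponential form gives measurability of the weights and exposes the expression
    [x exp (- x)] behind the entropy bound. *)
Lemma gibbsE u i t : w u i t = expR (- (k i t - u i + ln (S u t))).
Proof. by rewrite opprD opprB expRD expRN lnK ?posrE. Qed.

Lemma measurable_partition_fun u : measurable_fun setT (S u).
Proof.
apply: measurable_sum => i; apply: measurableT_comp => //.
exact: measurable_funB.
Qed.

Lemma measurable_gibbs u i : measurable_fun setT (w u i).
Proof.
rewrite (_ : w u i = fun t => expR (- (k i t - u i + ln (S u t)))); last first.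
  by apply/funext => t; exact: gibbsE.
apply: measurableT_comp => //; apply: measurableT_comp => //.
apply: measurable_funD; first exact: measurable_funB.
by apply: measurableT_comp => //; exact: measurable_partition_fun.
Qed.

Lemma ln_partition_fun_ge u i t : u i - k i t <= ln (S u t).
Proof.
rewrite -ler_expR lnK ?posrE// /S (bigD1 i)//= lerDl sumr_ge0//.
Qed.

Lemma ln_partition_fun_le u t : ln (S u t) <= ln (\sum_i expR (u i)).
Proof.
have lesum : S u t <= \sum_i expR (u i).
  by apply: ler_sum => i _; rewrite ler_expR gerBl k_ge0.
by rewrite ler_ln// posrE// (lt_le_trans _ lesum).
Qed.

Lemma integrable_ln_partition_fun u :
  Q.-integrable setT (EFin \o (fun t => ln (S u t))).
Proof.
apply: (@Rintegrable_dominated _ _ _ _ _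
  (fun t => (`|u i0| + `|ln (\sum_i expR (u i))|) + k i0 t)).
- by apply: measurableT_comp => //; exact: measurable_partition_fun.
- by apply: RintegrableD => //; exact: Rintegrable_cst.
- move=> t; have := ln_partition_fun_ge u i0 t; have := ln_partition_fun_le u t.
  have := k_ge0 i0 t; have := ler_norm (ln (\sum_i expR (u i))).
  have := ler_norm (- u i0); rewrite normrN.
  have := normr_ge0 (ln (\sum_i expR (u i))); have := normr_ge0 (u i0).
  by rewrite ler_norml => *; apply/andP; split; lra.
Qed.

Lemma integrable_gibbs u i : Q.-integrable setT (EFin \o w u i).
Proof.
apply: (@Rintegrable_bounded _ _ _ _ _ 1); first exact: measurable_gibbs.
by move=> t; rewrite ger0_norm ?gibbs_le1// ltW// gibbs_gt0.
Qed.

(** Averaging [u i - k i t <= ln (S u t)] over [i] with weights [p i] cancels the linear term; the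
    infimum of the functional is therefore finite. *)
Lemma entropic_loss_lower u : - \sum_i p i * \int[Q]_t k i t <= Psi u.
Proof.
suff : \int[Q]_t (\sum_i p i * (u i - k i t)) <= \int[Q]_t ln (S u t).
  have iuk i : Q.-integrable setT (EFin \o (fun t => u i - k i t)).
    by apply: RintegrableB => //; exact: Rintegrable_cst.
  rewrite Rintegral_sum; last by move=> i; exact: RintegrableZl.
  under eq_bigr => i _.
    rewrite RintegralZl// RintegralB//; last exact: Rintegrable_cst.
    rewrite Rintegral_cst1 mulrBr; over.
  rewrite sumrB /Psi; lra.
apply: le_Rintegral => //.
- apply: Rintegrable_sum => i; apply: RintegrableZl.
  by apply: RintegrableB => //; exact: Rintegrable_cst.
- exact: integrable_ln_partition_fun.
move=> t _; rewrite -[leRHS]mul1r -p_sum1 mulr_suml ler_sum// => i _.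
by rewrite ler_wpM2l ?ln_partition_fun_ge// ltW.
Qed.

Lemma partition_fun_shift u r t : S (fun i => u i + r) t = expR r * S u t.
Proof.
by rewrite /S mulr_sumr; apply: eq_bigr => i _; rewrite -expRD; congr expR; ring.
Qed.

(** Since the [p i] sum to 1, constants added to [u] cancel. This permits the normalisation
    [\sum_i expR (u i) = 1], which makes both [u] and [ln (S u)] nonpositive. *)
Lemma entropic_loss_shift u r : Psi (fun i => u i + r) = Psi u.
Proof.
rewrite /Psi; under eq_Rintegral.
  move=> t _; rewrite partition_fun_shift lnM ?posrE ?expR_gt0// expRK; over.
rewrite RintegralD//; [|exact: Rintegrable_cst|exact: integrable_ln_partition_fun].
rewrite Rintegral_cst1; under eq_bigr do rewrite mulrDr.
by rewrite big_split/= -mulr_suml p_sum1; lra.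
Qed.

Lemma entropic_loss_near_min e : 0 < e ->
  exists u, \sum_i expR (u i) = 1 /\ forall v, Psi u <= Psi v + e.
Proof.
move=> e0; have hinf : has_inf (range Psi).
  split; first by exists (Psi (fun=> 0)), (fun=> 0).
  by exists (- \sum_i p i * \int[Q]_t k i t) => _ [u _ <-]; exact: entropic_loss_lower.
have [_ [u _ <-] ult] := inf_adherent e0 hinf.
have s0 : 0 < \sum_i expR (u i).
  by rewrite (bigD1 i0)//= ltr_pwDl ?expR_gt0// sumr_ge0//.
exists (fun i => u i + - ln (\sum_i expR (u i))); split.
  under eq_bigr do rewrite expRD expRN lnK ?posrE//.
  by rewrite -mulr_suml divff// gt_eqF.
move=> v; rewrite entropic_loss_shift (le_trans (ltW ult))// lerD2r.
by apply: ge_inf; [exact: hinf.2|exists v].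
Qed.

(* [ln (1 + x) <= x] applied to the ratio [S (u + s e_i) / S u = 1 + w_i (e^s - 1)]. *)
Lemma entropic_loss_perturb u i s :
  Psi (fun j => u j + s *+ (j == i)) <=
  Psi u + (expR s - 1) * \int[Q]_t w u i t - s * p i.
Proof.
have le_ln t : ln (S (fun j => u j + s *+ (j == i)) t) <=
    ln (S u t) + (expR s - 1) * w u i t.
  have -> : S (fun j => u j + s *+ (j == i)) t = S u t * (1 + (expR s - 1) * w u i t).
    rewrite mulrDr mulr1 mulrCA /w (mulrC (S u t)) divfK ?gt_eqF//.
    rewrite /S (bigD1 i)//= eqxx mulr1n [in RHS](bigD1 i)//=.
    rewrite addrAC (expRD (u i - k i t) s).
    rewrite (eq_bigr (fun j => expR (u j - k j t))); last first.
      by move=> j /negbTE ->; rewrite mulr0n addr0.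
    set X := expR (u i - k i t); set Y := \sum_(_ | _) _. ring.
  (* The quantity equals [(1 - w) + w e^s] with [0 < w <= 1]. *)
  have w1 : 0 < 1 + (expR s - 1) * w u i t.
    have := gibbs_le1 u i t; have := gibbs_gt0 u i t; have := expR_gt0 s; nra.
  rewrite lnM ?posrE// lerD2l; have := @le_ln1Dx R ((expR s - 1) * w u i t).
  by apply; lra.
rewrite /Psi; under [X in _ - X]eq_bigr do rewrite mulrDr.
rewrite big_split/=.
have -> : \sum_j p j * (s *+ (j == i)) = s * p i.
  rewrite (bigD1 i)//= eqxx mulr1n big1 ?addr0 1?mulrC// => j /negbTE ->.
  by rewrite mulr0n mulr0.
suff : \int[Q]_t ln (S (fun j => u j + s *+ (j == i)) t) <=
    \int[Q]_t ln (S u t) + (expR s - 1) * \int[Q]_t w u i t by lra.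
rewrite -RintegralZl//; last exact: integrable_gibbs.
rewrite -RintegralD//; last 2 first.
- exact: integrable_ln_partition_fun.
- by apply: RintegrableZl; exact: integrable_gibbs.
apply: le_Rintegral => //; first exact: integrable_ln_partition_fun.
apply: RintegrableD; first exact: integrable_ln_partition_fun.
by apply: RintegrableZl; exact: integrable_gibbs.
Qed.

(* The entropy term is at most [n], since [x * exp (- x) <= 1] for each index. *)
Lemma gibbs_cost_le u t :
  \sum_i w u i t * k i t <= \sum_i w u i t * u i - ln (S u t) + n%:R.
Proof.
have -> : ln (S u t) = \sum_i w u i t * ln (S u t).
  by rewrite -mulr_suml gibbs_sum1 mul1r.
rewrite -sumrB; have -> : n%:R = \sum_(i < n) 1 :> R by rewrite sumr_const card_ord.
rewrite -big_split/=.
apply: ler_sum => i _.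
suff : w u i t * (k i t - u i + ln (S u t)) <= 1 by lra.
rewrite gibbsE; set x := k i t - u i + ln (S u t).
rewrite expRN mulrC ler_pdivrMr ?expR_gt0// mul1r.
by have := expR_ge1Dx x; lra.
Qed.

(** An approximate first-order condition. Raising [u i] by [s] can lower the functional by at most
    [s ^ 2]; dividing by [s] the perturbation bound leaves an error [s] from near-minimality and
    [2 s] from the second-order term of [e^s]. *)
Lemma gibbs_marginal_ge u i s : 0 < s -> s <= 2^-1 ->
  (forall v, Psi u <= Psi v + s ^+ 2) -> p i - \int[Q]_t w u i t <= 3 * s.
Proof.
move=> s0 s2 umin.
have q0 : 0 <= \int[Q]_t w u i t.
  by apply: Rintegral_ge0 => t _; exact/ltW/gibbs_gt0.
have q1 : \int[Q]_t w u i t <= 1.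
  rewrite -[leRHS](Rintegral_cst1 Q); apply: le_Rintegral => //.
  - exact: integrable_gibbs.
  - exact: Rintegrable_cst.
  - by move=> t _; exact: gibbs_le1.
(* From [e^(-s) >= 1 - s] one gets [e^s (1 - s) <= 1], while [(1 + s + 2 s^2) (1 - s) = 1 + s^2 - 2
   s^3 >= 1] for [s <= 1/2]. *)
have es : expR s <= 1 + s + 2 * s ^+ 2.
  have s1 : 0 < 1 - s by lra.
  rewrite -(ler_pM2r s1); apply: (@le_trans _ _ 1); last by nra.
  have := expR_ge1Dx (- s); rewrite expRN => es.
  rewrite -[leRHS](@mulfV _ (expR s)) ?gt_eqF ?expR_gt0// ler_pM2l ?expR_gt0//.
have := entropic_loss_perturb u i s.
have := umin (fun j => u j + s *+ (j == i)) => h1 h2.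
have : s * p i <= s * (\int[Q]_t w u i t + 3 * s).
  have : (expR s - 1) * \int[Q]_t w u i t <= (s + 2 * s ^+ 2) * \int[Q]_t w u i t.
    by apply: ler_wpM2r => //; lra.
  by nra.
by rewrite ler_pM2l//; lra.
Qed.

(** The right-hand side does not depend on [u], so potentials stay bounded while the accuracy of the
    near-minimiser improves. All terms [p j * - u j] are nonnegative after normalisation, and their
    sum is controlled by comparing with the zero potential. *)
Lemma near_min_potential_bound u i : \sum_i expR (u i) = 1 ->
  (forall v, Psi u <= Psi v + 1) ->
  p i * - u i <= Psi (fun=> 0) + 1 + \sum_j \int[Q]_t k j t.
Proof.
move=> u1 umin.
have u_le0 j : u j <= 0.
  rewrite -ler_expR expR0 -u1 (bigD1 j)//= lerDl sumr_ge0//.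
(* Each [exp (- k i t)] is at least [exp (- \sum_j k j t)], and the factors [exp (u i)] sum to 1. *)
have lnS t : - ln (S u t) <= \sum_j k j t.
  rewrite lerNl -ler_expR lnK ?posrE// -[leLHS]mulr1 -u1 mulr_sumr.
  apply: ler_sum => j _; rewrite -expRD ler_expR addrC lerD2l lerN2.
  by rewrite (bigD1 j)//= lerDl sumr_ge0.
have ES : - (\int[Q]_t ln (S u t)) <= \sum_j \int[Q]_t k j t.
  rewrite -Rintegral_sum//.
  have -> : - (\int[Q]_t ln (S u t)) = \int[Q]_t (-1 * ln (S u t)).
    by rewrite RintegralZl ?mulN1r//; exact: integrable_ln_partition_fun.
  apply: le_Rintegral => //.
  - by apply: RintegrableZl; exact: integrable_ln_partition_fun.
  - exact: Rintegrable_sum.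
  - by move=> t _; rewrite mulN1r.
have : p i * - u i <= \sum_j p j * - u j.
  by rewrite (bigD1 i)//= lerDl sumr_ge0// => j _; rewrite mulr_ge0 ?oppr_ge0// ltW.
have := umin (fun=> 0); rewrite {1}/Psi.
under [in X in _ -> X -> _]eq_bigr do rewrite mulrN.
rewrite sumrN; lra.
Qed.

(** The last bound is approximate complementary slackness: a marginal error of order [s] is
    multiplied by potentials bounded independently of [s]. *)
Lemma entropic_near_min_marginals e : 0 < e -> exists u,
  [/\ \sum_i expR (u i) = 1, forall i, p i - \int[Q]_t w u i t <= e
    & \sum_i (p i - \int[Q]_t w u i t) * - u i <= e].
Proof.
move=> e0; pose B := `|Psi (fun=> 0) + 1 + \sum_j \int[Q]_t k j t|.
pose C := \sum_i (p i)^-1.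
have C0 : 0 <= C by apply: sumr_ge0 => i _; rewrite invr_ge0 ltW.
have B0 : 0 <= B by exact: normr_ge0.
have BC0 : 0 <= B * C by exact: mulr_ge0.
(* Since [- u i <= B / p i], the slackness sum is at most [3 s B C]. This [s] makes both that and
   the marginal error [3 s] at most [e]; the cap [1/2] serves the expansion of [e^s]. *)
pose s := Num.min (2^-1) (e / (3 * (1 + B * C))).
have D0 : 0 < 3 * (1 + B * C) by lra.
have s0 : 0 < s by rewrite lt_min invr_gt0 divr_gt0// andbT; lra.
have s2 : s <= 2^-1 by rewrite ge_min lexx.
have sD : s * (3 * (1 + B * C)) <= e.
  by rewrite -ler_pdivlMr// ge_min lexx orbT.
have [u [u1 umin]] := entropic_loss_near_min (exprn_gt0 2 s0).
have marg i := gibbs_marginal_ge i s0 s2 umin.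
have u_le0 j : u j <= 0.
  rewrite -ler_expR expR0 -u1 (bigD1 j)//= lerDl sumr_ge0//.
exists u; split => // [i|]; first by have := marg i; nra.
apply: (@le_trans _ _ (\sum_i (3 * s * (B * (p i)^-1)))).
  apply: ler_sum => i _.
  have ub : - u i <= B * (p i)^-1.
    rewrite ler_pdivlMr// mulrC (le_trans (near_min_potential_bound i u1 _))//.
      by move=> v; rewrite (le_trans (umin v))// lerD2l; nra.
    exact: ler_norm.
  apply: (@le_trans _ _ (3 * s * - u i)).
    by rewrite ler_wpM2r// oppr_ge0.
  by rewrite ler_wpM2l//; lra.
rewrite -!mulr_sumr -/C; nra.
Qed.

(** A uniform change of the costs moves their soft minimum by no more, so the soft minimum of
    1-Lipschitz costs is 1-Lipschitz. *)
Lemma ln_partition_fun_lipschitz u t t' x :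
  (forall i, k i t <= k i t' + x) -> ln (S u t') <= ln (S u t) + x.
Proof.
move=> kx; rewrite -ler_expR expRD !lnK ?posrE// /S mulr_suml.
by apply: ler_sum => i _; rewrite -expRD ler_expR; have := kx i; lra.
Qed.

End softmin.

(* The potential is the soft minimum of the [c i + h i] at a small temperature;
   using it instead of the hard minimum makes the weights explicit. *)
Lemma entropic_duality {R : realType} d (T : measurableType d)
    (Q : probability T R) n (p : 'I_n -> R) (c : 'I_n -> T -> R) (e : R) :
  (forall i, 0 < p i) -> \sum_i p i = 1 ->
  (forall i, measurable_fun setT (c i)) -> (forall i t, 0 <= c i t) ->
  (forall i, Q.-integrable setT (EFin \o c i)) -> 0 < e ->
  exists (h : 'I_n -> R) (w : 'I_n -> T -> R) (G : T -> R),
  [/\ forall i, 0 <= h i, forall i, measurable_fun setT (w i),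
      forall i t, 0 <= w i t & forall t, \sum_i w i t = 1] /\
  [/\ measurable_fun setT G, forall t, 0 <= G t, forall i t, G t <= c i t + h i &
      forall t t' x, (forall i, c i t <= c i t' + x) -> G t <= G t' + x] /\
  [/\ \sum_i `|\int[Q]_t w i t - p i| <= e &
      \int[Q]_t (\sum_i w i t * c i t) <= \int[Q]_t G t - \sum_i p i * h i + e].
Proof.
move=> p0 p1 mc c0 ic e0.
case: n p c p0 p1 mc c0 ic => [p c _ /eqP|n p c p0 p1 mc c0 ic].
  by rewrite big_ord0 eq_sym oner_eq0.
(* The temperature: the entropy term, at most [n.+1] before scaling, then costs at most [e / 2]. *)
pose a := e / (2 * n.+1%:R).
have n0 : 0 < n.+1%:R :> R by rewrite ltr0n.
have a0 : 0 < a by rewrite divr_gt0// mulr_gt0.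
have aE : a * n.+1%:R = e / 2 by rewrite /a; field; rewrite ?gt_eqF//; lra.
pose k i t := a^-1 * c i t.
have mk i : measurable_fun setT (k i) by exact: measurable_funM.
have k0 i t : 0 <= k i t by rewrite mulr_ge0// invr_ge0 ltW.
have ik i : Q.-integrable setT (EFin \o k i) by exact: RintegrableZl.
have ck i t : c i t = a * k i t by rewrite mulrA divff ?mul1r// gt_eqF.
(* The first bound makes the rescaled slackness [a b] at most [e / 2], the second makes the total
   marginal error [2 b n.+1] at most [e]. *)
pose b := Num.min (e / (2 * a)) (e / (2 * n.+1%:R)).
have b0 : 0 < b by rewrite lt_min !divr_gt0 ?mulr_gt0.
have ba : a * b <= e / 2.
  have : b <= e / (2 * a) by rewrite ge_min lexx.
  by rewrite ler_pdivlMr ?mulr_gt0//; lra.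
have bn : 2 * b * n.+1%:R <= e.
  have : b <= e / (2 * n.+1%:R) by rewrite ge_min lexx orbT.
  by rewrite ler_pdivlMr ?mulr_gt0//; lra.
have [u [u1 marg slack]] := entropic_near_min_marginals ord0 p0 p1 mk k0 ik b0.
have u_le0 j : u j <= 0.
  by rewrite -ler_expR expR0 -u1 (bigD1 j)//= lerDl sumr_ge0.
pose lnS t := ln (partition_fun k u t).
have ilnS : Q.-integrable setT (EFin \o lnS).
  exact: (integrable_ln_partition_fun ord0).
have iw i : Q.-integrable setT (EFin \o gibbs k u i).
  exact: (integrable_gibbs Q ord0).
have mlnS : measurable_fun setT lnS.
  by apply: measurableT_comp => //; exact: measurable_partition_fun.
(* Undoing the scaling by the temperature; the normalisation of [u] makes [h] and [G]
   nonnegative. *)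
exists (fun i => - (a * u i)), (gibbs k u), (fun t => - (a * lnS t)); split; split.
- by move=> i; rewrite -mulrN mulr_ge0 ?oppr_ge0// ltW.
- by move=> i; exact: (measurable_gibbs ord0).
- by move=> i t; exact/ltW/(gibbs_gt0 ord0).
- by move=> t; exact: (gibbs_sum1 ord0).
- split.
  + by apply: measurableT_comp => //; exact: measurable_funM.
  + move=> t; rewrite -mulrN mulr_ge0 ?oppr_ge0 ?(ltW a0)//.
    by rewrite (le_trans (ln_partition_fun_le ord0 k0 u t))// u1 ln1.
  + move=> i t; rewrite ck -mulrBr -mulrN ler_pM2l//.
    by have := ln_partition_fun_ge ord0 k u i t; rewrite -/(lnS t); lra.
  + move=> t t' x cx.
    have kx i : k i t <= k i t' + a^-1 * x.
      by rewrite -mulrDr ler_pM2l ?invr_gt0.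
    have := ln_partition_fun_lipschitz ord0 u kx; rewrite -/(lnS t) -/(lnS t').
    rewrite -(ler_pM2l a0) mulrDr mulrA divff ?gt_eqF// mul1r; lra.
- have qsum : \sum_i \int[Q]_t gibbs k u i t = 1.
    rewrite -Rintegral_sum//; under eq_Rintegral do rewrite (gibbs_sum1 ord0).
    exact: Rintegral_cst1.
  split.
    (* A one-sided bound suffices: [r <= b] implies [|r| <= 2 b - r], and the differences [r] sum to
       0 because both families have total mass 1. *)
    apply: (@le_trans _ _ (\sum_i (2 * b - (p i - \int[Q]_t gibbs k u i t)))).
      apply: ler_sum => i _; have := marg i => mi.
      by rewrite ler_norml; apply/andP; split; lra.
    rewrite sumrB sumrB p1 qsum subrr subr0 sumr_const card_ord -mulr_natr; lra.
  have icost i : Q.-integrable setT (EFin \o (fun t => gibbs k u i t * c i t)).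
    apply: (Rintegrable_dominated _ (ic i)).
      by apply: measurable_funM => //; exact: (measurable_gibbs ord0).
    move=> t; have g0 := ltW (gibbs_gt0 ord0 k u i t); rewrite ger0_norm ?(mulr_ge0 g0)//.
    by rewrite -[leRHS]mul1r ler_wpM2r// (gibbs_le1 ord0).
  have iwu i : Q.-integrable setT (EFin \o (fun t => u i * gibbs k u i t)).
    exact: RintegrableZl.
  have step : \int[Q]_t (\sum_i gibbs k u i t * c i t) <=
      \int[Q]_t (a * (\sum_i u i * gibbs k u i t + (-1 * lnS t + n.+1%:R))).
    apply: le_Rintegral => //.
    + exact: Rintegrable_sum.
    + apply: RintegrableZl; apply: RintegrableD; first exact: Rintegrable_sum.
      by apply: RintegrableD; [exact: RintegrableZl|exact: Rintegrable_cst].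
    + move=> t _; under eq_bigr do rewrite ck mulrCA.
      rewrite -mulr_sumr ler_pM2l//.
      have := gibbs_cost_le ord0 k u t; rewrite -/(lnS t) => /le_trans; apply.
      by under eq_bigr do rewrite mulrC; lra.
  apply: (le_trans step); rewrite RintegralZl//; last first.
    apply: RintegrableD; first exact: Rintegrable_sum.
    by apply: RintegrableD; [exact: RintegrableZl|exact: Rintegrable_cst].
  rewrite RintegralD//; [|exact: Rintegrable_sum|by apply: RintegrableD; [exact: RintegrableZl|exact: Rintegrable_cst]].
  rewrite RintegralD//; [|exact: RintegrableZl|exact: Rintegrable_cst].
  rewrite Rintegral_cst1 RintegralZl// Rintegral_sum//.
  under [X in _ * (X + _)]eq_bigr do rewrite RintegralZl//.
  have -> : \int[Q]_t (- (a * lnS t)) = - (a * \int[Q]_t lnS t).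
    under eq_Rintegral do rewrite -mulNr; by rewrite RintegralZl// mulNr.
  have -> : \sum_i p i * - (a * u i) = a * (\sum_i p i * - u i).
    by rewrite mulr_sumr; apply: eq_bigr => i _; ring.
  (* Replacing [\int w_i dQ] by [p i] in the linear term costs exactly this slackness sum. *)
  have sl : a * \sum_i (p i - \int[Q]_t gibbs k u i t) * - u i <= a * b.
    by rewrite ler_pM2l.
  have E3 : \sum_i (p i - \int[Q]_t gibbs k u i t) * - u i =
    \sum_i p i * - u i + \sum_i u i * \int[Q]_t gibbs k u i t.
    by rewrite -big_split/=; apply: eq_bigr => i _; ring.
  rewrite E3 mulrDr in sl; rewrite !mulrDr aE; lra.
Qed.

(** * Mean deviation of a sample mean *)

Section sample_mean.
Context {R : realType} dO (Omega : measurableType dO) (Pr : probability Omega R).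
Context dT (T : measurableType dT) (Q : probability T R) {m : nat}.
Variable Y : 'I_m -> Omega -> T.
Hypothesis m_gt0 : (0 < m)%N.
Hypothesis Y_meas : forall k, measurable_fun setT (Y k).
Hypothesis Y_law : forall k A, measurable A -> Pr (Y k @^-1` A) = Q A.
Hypothesis Y_indep : forall k l A B, k != l -> measurable A -> measurable B ->
  Pr (Y k @^-1` A `&` Y l @^-1` B) = (Q A * Q B)%E.

Lemma integrable_sample k (f : T -> R) : Q.-integrable setT (EFin \o f) ->
  Pr.-integrable setT (EFin \o (fun w => f (Y k w))).
Proof.
move=> /integrableP[mf iF]; apply/integrableP; split.
  exact: measurableT_comp mf (Y_meas k).
rewrite (_ : (\int[_]_(x in _) _ = \int[Q]_t `|(EFin \o f) t|)%E)//.
rewrite (eq_measure_integral (pushforward Pr (Y k))); last first.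
  by move=> A mA _; exact/esym/(Y_law k mA).
rewrite ge0_integral_pushforward//.
exact: measurableT_comp.
Qed.

Lemma Rintegral_sample k (f : T -> R) : Q.-integrable setT (EFin \o f) ->
  \int[Pr]_w f (Y k w) = \int[Q]_t f t.
Proof.
move=> iF; congr fine; have := integrable_sample k iF; case/integrableP: (iF) => mf _ iY.
rewrite (eq_measure_integral (pushforward Pr (Y k))); last first.
  by move=> A mA _; exact/esym/(Y_law k mA).
by rewrite integral_pushforward.
Qed.

(** Independence on rectangles identifies the joint law of the pair with [Q \x Q], and Fubini
    factors the integral. *)
Lemma Rintegral_sample_prod k l (f : T -> R) : k != l ->
  measurable_fun setT f -> Q.-integrable setT (EFin \o f) ->
  Pr.-integrable setT (EFin \o (fun w => f (Y k w) * f (Y l w))) ->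
  \int[Pr]_w (f (Y k w) * f (Y l w)) = (\int[Q]_t f t) ^+ 2.
Proof.
move=> kl mf iF iff.
pose phi w := (Y k w, Y l w).
have mphi : measurable_fun setT phi by exact: measurable_fun_pair.
pose g (z : T * T) := (f z.1 * f z.2)%:E.
have mg : measurable_fun setT g.
  by apply/measurable_EFinP; apply: measurable_funM; apply: measurableT_comp.
have eqm X : measurable X -> (Q \x Q)%E X = pushforward Pr phi X.
  apply: product_measure_unique => A B mA mB.
  by rewrite -(Y_indep kl mA mB).
have ig : (Q \x Q)%E.-integrable setT g.
  apply/integrableP; split => //.
  rewrite (eq_measure_integral (pushforward Pr phi)); last by move=> A mA _; exact: eqm.
  by have /integrableP[] := integrable_pushforward mphi mg iff measurableT.
rewrite /Rintegral -[X in fine X]/(\int[Pr]_(w in phi @^-1` setT) (g \o phi) w)%E.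
rewrite -integral_pushforward//.
rewrite (eq_measure_integral (Q \x Q)%E); last by move=> A mA _; exact/esym/eqm.
rewrite -integral12_prod_meas1//.
under eq_integral do rewrite /g/=.
have -> : (\int[Q]_x \int[Q]_y (f x * f y)%:E = \int[Q]_x (f x * \int[Q]_t f t)%:E)%E.
  apply: eq_integral => x _.
  rewrite -RintegralZl// fineK//; apply: integrable_fin_num => //.
  exact: RintegrableZl.
rewrite -[LHS]/(\int[Q]_x (f x * \int[Q]_t f t)).
by rewrite RintegralZr// expr2.
Qed.

(* AM-GM [2 |s| <= s^2 / x + x] replaces the Cauchy-Schwarz inequality. *)
Lemma sample_mean_L1 (f : T -> R) (b V x : R) : measurable_fun setT f ->
  (\int[Q]_t ((f t - b) ^+ 2)%:E <= V%:E)%E -> 0 < x ->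
  (\int[Pr]_w (`|m%:R^-1 * (\sum_k f (Y k w)) - \int[Q]_t f t|)%:E <=
   ((V / (m%:R * x) + x) / 2)%:E)%E.
Proof.
move=> mf fV x0.
have mR : 0 < m%:R :> R by rewrite ltr0n.
have ib2 : Q.-integrable setT (EFin \o (fun t => (f t - b) ^+ 2)).
  apply/integrableP; split.
    by apply/measurable_EFinP; apply: measurable_funX; exact: measurable_funB.
  apply: le_lt_trans (ltry V); apply: le_trans fV.
  under eq_integral do rewrite /= ger0_norm ?sqr_ge0//.
  by [].
have ib : Q.-integrable setT (EFin \o (fun t => f t - b)).
  apply: (@Rintegrable_dominated _ _ _ _ _ (fun t => 1 + (f t - b) ^+ 2)).
  - exact: measurable_funB.
  - by apply: RintegrableD => //; exact: Rintegrable_cst.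
  - move=> t; set y := f t - b; have := sqr_ge0 (y - 1); have := sqr_ge0 (y + 1).
    by have := sqr_ge0 y; rewrite ler_norml => *; apply/andP; split; nra.
have iF : Q.-integrable setT (EFin \o f).
  have := RintegrableD ib (Rintegrable_cst Q b).
  by apply: eq_integrable => // t _ /=; rewrite subrK.
set c := \int[Q]_t f t.
pose g t := f t - c.
have mg : measurable_fun setT g by exact: measurable_funB.
have ig : Q.-integrable setT (EFin \o g).
  by apply: RintegrableB => //; exact: Rintegrable_cst.
have Eg : \int[Q]_t g t = 0.
  by rewrite RintegralB//; [rewrite Rintegral_cst1 subrr|exact: Rintegrable_cst].
(* The variance is at most the second moment about any centre [b]: the cross term has integral 0 and
   the constant is nonpositive. *)
have g2E t : g t ^+ 2 = (f t - b) ^+ 2 + ((2 * (b - c)) * g t - (b - c) ^+ 2).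
  by rewrite /g; ring.
have ilin : Q.-integrable setT (EFin \o (fun t => (2 * (b - c)) * g t - (b - c) ^+ 2)).
  by apply: RintegrableB; [exact: RintegrableZl|exact: Rintegrable_cst].
have ig2 : Q.-integrable setT (EFin \o (fun t => g t ^+ 2)).
  have := RintegrableD ib2 ilin.
  by apply: eq_integrable => // t _ /=; rewrite g2E.
have Eg2 : \int[Q]_t (g t ^+ 2) <= V.
  under eq_Rintegral do rewrite g2E.
  rewrite RintegralD// RintegralB//; [|exact: RintegrableZl|exact: Rintegrable_cst].
  rewrite RintegralZl// Eg mulr0 sub0r Rintegral_cst1.
  have : \int[Q]_t ((f t - b) ^+ 2) <= V.
    by rewrite -lee_fin /Rintegral fineK//; exact: integrable_fin_num.
  by have := sqr_ge0 (b - c); lra.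
have igg k l : Pr.-integrable setT (EFin \o (fun w => g (Y k w) * g (Y l w))).
  apply: (@Rintegrable_dominated _ _ _ _ _ (fun w => g (Y k w) ^+ 2 + g (Y l w) ^+ 2)).
  - by apply: measurable_funM; apply: measurableT_comp.
  - by apply: RintegrableD; apply: (integrable_sample _ ig2).
  - move=> w; set y := g (Y k w); set z := g (Y l w).
    have := sqr_ge0 (y - z); have := sqr_ge0 (y + z); have := sqr_ge0 y.
    have := sqr_ge0 z; rewrite ler_norml => *; apply/andP; split; nra.
pose s w := m%:R^-1 * (\sum_k f (Y k w)) - c.
have sE w : s w ^+ 2 = m%:R^-1 ^+ 2 * (\sum_k \sum_l g (Y k w) * g (Y l w)).
  have -> : \sum_k \sum_l g (Y k w) * g (Y l w) = (\sum_k g (Y k w)) ^+ 2.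
    by rewrite expr2 mulr_suml; apply: eq_bigr => k _; rewrite mulr_sumr.
  rewrite -exprMn; congr (_ ^+ 2); rewrite sumrB sumr_const card_ord mulrBr.
  by rewrite -[c *+ m]mulr_natl mulKf// gt_eqF.
have iss : Pr.-integrable setT (EFin \o (fun w => s w ^+ 2)).
  have : Pr.-integrable setT (EFin \o
      (fun w => m%:R^-1 ^+ 2 * (\sum_k \sum_l g (Y k w) * g (Y l w)))).
    by apply: RintegrableZl; do 2 apply: Rintegrable_sum => ?.
  by apply: eq_integrable => // w _ /=; rewrite sE.
have Es : \int[Pr]_w (s w ^+ 2) <= V / m%:R.
  under eq_Rintegral do rewrite sE.
  rewrite RintegralZl//; last by do 2 apply: Rintegrable_sum => ?.
  rewrite Rintegral_sum//; last by move=> ?; apply: Rintegrable_sum => ?.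
  (* For fixed [k] only the diagonal term survives, since [g] is centred and distinct sample points
     are independent. *)
  rewrite (eq_bigr (fun=> \int[Q]_t (g t ^+ 2))); last first.
    move=> k _; rewrite Rintegral_sum// (bigD1 k)//= big1 ?addr0.
      by rewrite -(Rintegral_sample k ig2); apply: eq_Rintegral.
    by move=> l lk; rewrite Rintegral_sample_prod// 1?eq_sym// Eg expr0n.
  rewrite sumr_const card_ord -[X in _ * X]mulr_natl ler_pdivlMr//.
  have -> : m%:R^-1 ^+ 2 * (m%:R * \int[Q]_t (g t ^+ 2)) * m%:R = \int[Q]_t (g t ^+ 2).
    by field; rewrite gt_eqF.
  exact: Eg2.
have ms : measurable_fun setT s.
  apply: measurable_funB => //; apply: measurable_funM => //.
  by apply: measurable_sum => k; exact: measurableT_comp.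
pose B w := (2 * x)^-1 * (s w ^+ 2) + x / 2.
have iB : Pr.-integrable setT (EFin \o B).
  by apply: RintegrableD; [exact: RintegrableZl|exact: Rintegrable_cst].
apply: (@le_trans _ _ (\int[Pr]_w (B w)%:E)%E).
  apply: ge0_le_integral => //.
  - by apply/measurable_EFinP; apply: measurableT_comp.
  - by case/integrableP: iB.
  - move=> w _; rewrite lee_fin -/(s w) /B.
    rewrite mulrC addrC -subr_ge0.
    have -> : x / 2 + s w ^+ 2 / (2 * x) - `|s w| = (x - `|s w|) ^+ 2 / (2 * x).
      by rewrite -(real_normK (num_real (s w))); field; rewrite gt_eqF.
    by rewrite divr_ge0 ?sqr_ge0//; lra.
rewrite -[leLHS]fineK; last exact: integrable_fin_num.
rewrite lee_fin -[leLHS]/(\int[Pr]_w B w).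
rewrite RintegralD//; [|exact: RintegrableZl|exact: Rintegrable_cst].
rewrite Rintegral_cst1 RintegralZl// [leRHS]mulrDl lerD2r.
have -> : V / (m%:R * x) / 2 = (2 * x)^-1 * (V / m%:R).
  by field; rewrite !gt_eqF.
by rewrite ler_pM2l// invr_gt0; lra.
Qed.

End sample_mean.

(** * Semi-discrete transport *)

Section stochastic_correction.
Context {R : realType} {n : nat}.
Variables p q : 'I_n -> R.
Hypotheses (p_ge0 : forall i, 0 <= p i) (q_ge0 : forall i, 0 <= q i).
Hypotheses (p_sum1 : \sum_i p i = 1) (q_sum1 : \sum_i q i = 1).

(* Keep the common mass [min p q] in place and spread the excess of [q]
   proportionally to the deficit. *)
Lemma stochastic_correction : exists M : 'I_n -> 'I_n -> R,
  [/\ forall i j, 0 <= M i j, forall i, \sum_j M i j = 1,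
      forall j, \sum_i q i * M i j = p j &
      \sum_i q i * (1 - M i i) <= \sum_i `|q i - p i|].
Proof.
(* [a i] is the fraction of the mass at [i] that stays and [r j] is the deficit at [j]. The second
   branch has [q i > 0], so its division is genuine. *)
pose a i := if q i <= p i then 1 else p i / q i.
pose r j := p j - q j * a j.
have a0 i : 0 <= a i by rewrite /a; case: ifP => // _; rewrite divr_ge0.
have a1 i : a i <= 1.
  rewrite /a; case: ifPn => //; rewrite -ltNge => pq.
  by rewrite ler_pdivrMr ?mul1r ?(ltW pq)// (le_lt_trans (p_ge0 i)).
have qa i : q i * a i = if q i <= p i then q i else p i.
  rewrite /a; case: ifPn; first by rewrite mulr1.
  rewrite -ltNge => pq; rewrite mulrC divfK// gt_eqF// (le_lt_trans (p_ge0 i))//.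
have r0 j : 0 <= r j by rewrite /r qa; case: ifPn => [|_]; rewrite ?subr_ge0// subrr.
have rS : \sum_j r j = \sum_i q i * (1 - a i).
  under [RHS]eq_bigr do rewrite mulrBr mulr1.
  by rewrite !sumrB p_sum1 q_sum1.
set s := \sum_j r j in rS.
have s0 : 0 <= s by exact: sumr_ge0.
(* When nothing has to move, [r j / s] is 0 by the convention on division by 0, so the rows of [M]
   sum to 1 only because every [a i] is 1. *)
have s_eq0_a i : s = 0 -> a i = 1.
  move=> /eqP; rewrite rS psumr_eq0; last by move=> j _; rewrite mulr_ge0// subr_ge0.
  move=> /allP/(_ i (mem_index_enum _))/=; rewrite mulf_eq0 => /orP[/eqP qi0|].
    by rewrite /a qi0 p_ge0.
  by rewrite subr_eq0 => /eqP.
have s_eq0_r j : s = 0 -> r j = 0.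
  move=> /eqP; rewrite psumr_eq0//.
  by move=> /allP/(_ j (mem_index_enum _))/= /eqP.
exists (fun i j => a i *+ (i == j) + (1 - a i) * (r j / s)); split.
- by move=> i j; rewrite addr_ge0 ?mulrn_wge0// mulr_ge0 ?subr_ge0// divr_ge0.
- move=> i; rewrite big_split/= -mulr_sumr -mulr_suml -/s.
  rewrite (bigD1 i)//= eqxx mulr1n big1 ?addr0; last first.
    by move=> j ji; rewrite eq_sym (negbTE ji).
  have [s_0|s_n0] := eqVneq s 0; last by rewrite divff// mulr1; lra.
  by rewrite (s_eq0_a i s_0) subrr mul0r addr0.
- move=> j; under eq_bigr do rewrite mulrDr mulrA.
  rewrite big_split/= -mulr_suml -rS (bigD1 j)//= eqxx mulr1n big1 ?addr0; last first.
    by move=> i ij; rewrite (negbTE ij) mulr0.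
  have [s_0|s_n0] := eqVneq s 0; last by rewrite [s * _]mulrC divfK// /r; lra.
  by have := s_eq0_r j s_0; rewrite s_0 mul0r /r; lra.
- apply: ler_sum => i _; rewrite eqxx mulr1n.
  apply: (@le_trans _ _ (q i * (1 - a i))).
    rewrite ler_wpM2l// lerB// lerDl mulr_ge0 ?subr_ge0// divr_ge0//.
  rewrite mulrBr mulr1 qa; case: ifPn => _; last exact: ler_norm.
  by rewrite subrr normr_ge0.
Qed.

End stochastic_correction.

Section semidiscrete_transport.
Context {R : realType} {d n : nat}.
Variables (x : 'I_n -> Rd R d) (p : 'I_n -> R) (P nu : probability (Rd R d) R).
Hypothesis p_ge0 : forall i, 0 <= p i.
Hypothesis p_sum1 : \sum_i p i = 1.
Hypothesis PE : forall A, measurable A -> (P A = \sum_i (p i)%:E * \d_(x i) A)%E.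

Let cost i (y : Rd R d) : R := enorm (x i - y : 'rV[R]_d).

Lemma measurable_cost i : measurable_fun setT (cost i).
Proof. exact: measurable_fun_enormB. Qed.

Lemma measurable_pair_cost :
  measurable_fun setT (fun z : Rd R d * Rd R d => (enorm (z.1 - z.2 : 'rV[R]_d))%:E).
Proof. by apply/measurable_EFinP; exact: measurable_fun_enormB. Qed.

(** Integrate [G y <= |x_i - y| + h_i] against an arbitrary coupling: the left side sees only the
    second marginal, the potential only the first. *)
Lemma W1_weak_duality (h : 'I_n -> R) (G : Rd R d -> R) : injective x ->
  (forall i, 0 <= h i) -> measurable_fun setT G -> (forall y, 0 <= G y) ->
  (forall i y, G y <= cost i y + h i) ->
  (\int[nu]_y (G y)%:E <= W1 P nu + (\sum_i p i * h i)%:E)%E.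
Proof.
move=> x_inj h0 mG G0 Gle; rewrite -leeBlDr//.
apply: le_ereal_inf_tmp => _ [pi pi_coupling <-]; rewrite leeBlDr//.
pose A i : set (Rd R d * Rd R d) := fst @^-1` [set x i].
have mX : measurable (range x).
  by rewrite -bigcup_imset1; apply: fin_bigcup_measurable => // i _; exact: measurable_set1_Rd.
have mA i : measurable (A i).
  by rewrite -[A i]setTI; apply: measurable_fst => //; exact: measurable_set1_Rd.
(* [H] carries the potential to pairs; by injectivity of [x] at most one indicator is nonzero. *)
pose H z := (\sum_i (h i)%:E * (\1_(A i) z)%:E)%E.
have mH : measurable_fun setT H.
  apply: emeasurable_sum => i; apply: emeasurable_funM => //.
  exact/measurable_EFinP.
have H0 z : (0 <= H z)%E.
  by apply: sume_ge0 => i _; rewrite mule_ge0// lee_fin.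
have IH : (\int[pi]_z H z = (\sum_i p i * h i)%:E)%E.
  rewrite ge0_integral_sum//; last 2 first.
  - by move=> i; apply: emeasurable_funM => //; exact/measurable_EFinP.
  - by move=> i z _; rewrite mule_ge0// lee_fin.
  rewrite -sumEFin; apply: eq_bigr => i _.
  rewrite ge0_integralZl_EFin//; last exact/measurable_EFinP.
  rewrite integral_indic// setIT.
  transitivity ((h i)%:E * P [set x i])%E.
    by congr (_ * _)%E; exact: (pi_coupling _ (measurable_set1_Rd (x i))).1.
  rewrite PE; last exact: measurable_set1_Rd.
  rewrite (bigD1 i)//= diracE mem_set// mule1 big1 ?adde0; last first.
    move=> j ji; rewrite diracE memNset ?mule0//= => /x_inj jE.
    by rewrite jE eqxx in ji.
  by rewrite -EFinM mulrC.
have Gsnd : (\int[nu]_y (G y)%:E = \int[pi]_z (G z.2)%:E)%E.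
  rewrite (eq_measure_integral (pushforward pi snd)); last first.
    by move=> B mB _; exact/esym/(pi_coupling _ mB).2.
  by rewrite ge0_integral_pushforward//; [exact/measurable_EFinP|move=> y _; rewrite lee_fin].
rewrite Gsnd -IH -ge0_integralD//; last 2 first.
- by move=> z _; rewrite lee_fin enorm_ge0.
- exact: measurable_pair_cost.
apply: ae_ge0_le_integral => //.
- by move=> z _; rewrite lee_fin.
- by apply/measurable_EFinP; exact: measurableT_comp.
- by move=> z _; rewrite adde_ge0// lee_fin enorm_ge0.
- by apply: emeasurable_funD => //; exact: measurable_pair_cost.
(* The pointwise inequality can fail only where the first coordinate is not an atom, a null set
   because the first marginal is [P]. *)
exists (fst @^-1` (~` range x)); split.
- rewrite -[X in measurable X]setTI; apply: measurable_fst => //; exact: measurableC.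
- have := (pi_coupling _ (measurableC mX)).1 => /= ->.
  rewrite PE; last exact: measurableC.
  by rewrite big1// => i _; rewrite diracE memNset ?mule0// => /(_ (imageT _ _)).
- move=> z /=; apply: contra_not => -[i _ xz] _.
  have -> : H z = (h i)%:E.
    rewrite /H (bigD1 i)//= indicE mem_set//= mule1 big1 ?adde0// => j ji.
    rewrite indicE memNset ?mule0//= => zj.
    by move: ji; rewrite (x_inj j i) ?eqxx// xz zj.
  by rewrite -EFinD lee_fin -xz; exact: Gle.
Qed.

(** The coupling is the law of [(x I, y)] with [y] of law [nu] and [I] drawn with weights [w i y].
    The condition on the integrals gives the first marginal, the sum to one gives the second. *)
Lemma W1_le_kernel_cost (w : 'I_n -> Rd R d -> R) :
  (forall i, measurable_fun setT (w i)) -> (forall i y, 0 <= w i y) ->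
  (forall y, \sum_i w i y = 1) -> (forall i, \int[nu]_y (w i y) = p i) ->
  (W1 P nu <= \int[nu]_y (\sum_i w i y * cost i y)%:E)%E.
Proof.
move=> mw w0 w1 wp.
have w_le1 i y : w i y <= 1.
  by rewrite -(w1 y) (bigD1 i)//= lerDl sumr_ge0.
have iw i : nu.-integrable setT (EFin \o w i).
  by apply: (@Rintegrable_bounded _ _ _ _ _ 1) => // y; rewrite ger0_norm.
have mphi i : measurable_fun setT (fun y : Rd R d => (x i, y)) by exact: measurable_fun_pair.
have [pi piE] := @mixture_ex R _ _ _ _ n nu w (fun i y => (x i, y)) mw mphi w0 w1.
apply: (@le_trans _ _ (\int[pi]_z (enorm (z.1 - z.2 : 'rV[R]_d))%:E)%E).
  apply: ereal_inf_lbound; exists pi => // A mA.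
  have ind (B : set (Rd R d * Rd R d)) : measurable B ->
      (pi B = \int[nu]_y (\sum_i (w i y)%:E * (\1_B (x i, y))%:E))%E.
    move=> mB; rewrite -[B in LHS]setIT -integral_indic// piE//.
    exact/measurable_EFinP.
  split.
    rewrite ind; last by rewrite -[X in measurable X]setTI; apply: measurable_fst.
    rewrite PE// ge0_integral_sum//; last 2 first.
    - move=> i; apply: emeasurable_funM; first exact/measurable_EFinP.
      have -> : (fun y : Rd R d => (\1_(fst @^-1` A) (x i, y))%:E) =
          cst (\1_A (x i))%:E :> (Rd R d -> \bar R).
        by apply/funext => y; rewrite !indicE.
      exact: measurable_cst.
    - by move=> i y _; rewrite mule_ge0 ?lee_fin.
    apply: eq_bigr => i _; rewrite -wp /Rintegral fineK; last first.
      exact: (integrable_fin_num measurableT (iw i)).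
    rewrite diracE muleC; under eq_integral do rewrite muleC.
    by rewrite -ge0_integralZl//; [exact/measurable_EFinP|move=> y _; rewrite lee_fin].
  rewrite ind; last by rewrite -[X in measurable X]setTI; apply: measurable_snd.
  rewrite -[A in RHS]setIT -integral_indic//; apply: eq_integral => y _.
  rewrite (eq_bigr (fun i => (w i y)%:E * (\1_A y)%:E)%E); last first.
    by move=> i _; rewrite !indicE.
  rewrite -ge0_sume_distrl; last by move=> i _; rewrite lee_fin.
  by rewrite sumEFin w1 mul1e.
rewrite piE; [|exact: measurable_pair_cost|by move=> z; rewrite lee_fin enorm_ge0].
rewrite le_eqVlt; apply/orP; left; apply/eqP; apply: eq_integral => y _.
by rewrite -sumEFin.
Qed.

(** The kernel [w] has first marginal [q] instead of [p]. Composing it with a stochastic matrix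
    carrying [q] to [p] repairs this; the mass moved is at most the sum of the [|q i - p i|], over
    distances at most [D]. *)
Lemma W1_le_approx_kernel_cost (w : 'I_n -> Rd R d -> R) (D : R) : 0 <= D ->
  (forall i j, enorm (x i - x j : 'rV[R]_d) <= D) ->
  (forall i, measurable_fun setT (w i)) -> (forall i y, 0 <= w i y) ->
  (forall y, \sum_i w i y = 1) ->
  (W1 P nu <= \int[nu]_y (\sum_i w i y * cost i y)%:E +
              (D * \sum_i `|\int[nu]_y w i y - p i|)%:E)%E.
Proof.
move=> D0 xD mw w0 w1.
have w_le1 i y : w i y <= 1.
  by rewrite -(w1 y) (bigD1 i)//= lerDl sumr_ge0.
have iw i : nu.-integrable setT (EFin \o w i).
  by apply: (@Rintegrable_bounded _ _ _ _ _ 1) => // y; rewrite ger0_norm.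
pose q i := \int[nu]_y w i y.
have q0 i : 0 <= q i by exact: Rintegral_ge0.
have q1 : \sum_i q i = 1.
  rewrite -Rintegral_sum//; under eq_Rintegral do rewrite w1.
  exact: Rintegral_cst1.
have [M [M0 M1 Mq Mcost]] := stochastic_correction p_ge0 q0 p_sum1 q1.
pose w' j y := \sum_i w i y * M i j.
have mw' j : measurable_fun setT (w' j).
  by apply: measurable_sum => i; exact: measurable_funM.
have w'0 j y : 0 <= w' j y by apply: sumr_ge0 => i _; rewrite mulr_ge0.
have w'1 y : \sum_j w' j y = 1.
  rewrite exchange_big/= -[RHS](w1 y); apply: eq_bigr => i _.
  by rewrite -mulr_sumr M1 mulr1.
have w'p j : \int[nu]_y w' j y = p j.
  rewrite Rintegral_sum; last first.
    move=> i; have := RintegrableZl (M i j) (iw i).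
    by apply: eq_integrable => // y _; rewrite /= mulrC.
  by rewrite -Mq; apply: eq_bigr => i _; rewrite RintegralZr.
have cost_le y : \sum_j w' j y * cost j y <=
    \sum_i w i y * cost i y + D * \sum_i w i y * (1 - M i i).
  have -> : \sum_j w' j y * cost j y = \sum_i w i y * \sum_j M i j * cost j y.
    under eq_bigr do rewrite mulr_suml.
    rewrite exchange_big/=; apply: eq_bigr => i _; rewrite mulr_sumr.
    by apply: eq_bigr => j _; rewrite mulrA.
  rewrite mulr_sumr -big_split/=; apply: ler_sum => i _.
  rewrite mulrCA -mulrDr ler_wpM2l//.
  (* Row [i] of [M] charges [D] for each jump to another atom, which dominates [cost j y] by the
     triangle inequality. *)
  have -> : cost i y + D * (1 - M i i) = \sum_j M i j * (cost i y + D *+ (j != i)).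
    under [RHS]eq_bigr do rewrite mulrDr.
    rewrite big_split/= -mulr_suml M1 mul1r; congr (_ + _).
    rewrite [RHS](bigD1 i)//= eqxx mulr0n mulr0 add0r.
    have -> : 1 - M i i = \sum_(j | j != i) M i j.
      by rewrite -(M1 i) (bigD1 i)//= addrAC subrr add0r.
    by rewrite mulr_sumr; apply: eq_bigr => j ->; rewrite mulr1n mulrC.
  apply: ler_sum => j _; rewrite ler_wpM2l//.
  have [->|ji] := eqVneq j i; first by rewrite mulr0n addr0.
  rewrite mulr1n addrC (le_trans (enormB_triangle (x i) _ _))//.
  by rewrite lerD2r xD.
apply: (le_trans (W1_le_kernel_cost mw' w'0 w'1 w'p)).
apply: (@le_trans _ _ (\int[nu]_y ((\sum_i w i y * cost i y)%:E +
   (D * \sum_i w i y * (1 - M i i))%:E))%E).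
  apply: ge0_le_integral => //.
  - by move=> y _; rewrite lee_fin sumr_ge0// => j _; rewrite mulr_ge0// enorm_ge0.
  - apply/measurable_EFinP; apply: measurable_sum => j.
    by apply: measurable_funM => //; exact: measurable_cost.
  - apply: emeasurable_funD; apply/measurable_EFinP.
      apply: measurable_sum => j.
      by apply: measurable_funM => //; exact: measurable_cost.
    apply: measurable_funM => //; apply: measurable_sum => i.
    exact: measurable_funM.
  - by move=> y _; rewrite -EFinD lee_fin cost_le.
have M_le1 i : M i i <= 1.
  by rewrite -(M1 i) (bigD1 i)//= lerDl sumr_ge0.
have iwM i : nu.-integrable setT (EFin \o (fun y => w i y * (1 - M i i))).
  have := RintegrableZl (1 - M i i) (iw i).
  by apply: eq_integrable => // y _; rewrite /= mulrC.
rewrite ge0_integralD//; last 4 first.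
- by move=> y _; rewrite lee_fin sumr_ge0// => j _; rewrite mulr_ge0// enorm_ge0.
- apply/measurable_EFinP; apply: measurable_sum => j.
  by apply: measurable_funM => //; exact: measurable_cost.
- move=> y _; rewrite lee_fin mulr_ge0// sumr_ge0// => j _.
  by rewrite mulr_ge0// subr_ge0.
- apply/measurable_EFinP; apply: measurable_funM => //; apply: measurable_sum => i.
  exact: measurable_funM.
apply: leeD => //.
rewrite -[leLHS]fineK; last first.
  apply: integrable_fin_num => //; apply: RintegrableZl.
  exact: Rintegrable_sum.
rewrite lee_fin -[leLHS]/(\int[nu]_y (D * \sum_i w i y * (1 - M i i))).
rewrite RintegralZl//; last exact: Rintegrable_sum.
rewrite Rintegral_sum// ler_wpM2l// (le_trans _ Mcost)//.
by apply: ler_sum => i _; rewrite RintegralZr.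
Qed.

End semidiscrete_transport.

(** [empirical y] is a bare set function; equality with a bundled probability lets the transport
    bounds be rewritten into [W1]. *)
Lemma empirical_probability {R : realType} {d m : nat} (y : 'I_m -> Rd R d) :
  (0 < m)%N -> exists nu : probability (Rd R d) R,
  empirical y = nu :> (set (Rd R d) -> \bar R) /\
  forall f : Rd R d -> R, measurable_fun setT f -> (forall z, 0 <= f z) ->
    (\int[nu]_z (f z)%:E = (m%:R^-1 * \sum_k f (y k))%:E)%E.
Proof.
move=> m0; have mR : 0 < m%:R :> R by rewrite ltr0n.
have [//||nu [nuE nuI]] := @dirac_mixture_ex R _ (Rd R d) m (fun=> m%:R^-1) y.
  by rewrite sumr_const card_ord -[_^-1 *+ m]mulr_natl mulfV// gt_eqF.
exists nu; split.
  by apply/funext => A; rewrite nuE /empirical ge0_sume_distrr.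
move=> f mf f0; rewrite nuI//; last exact/measurable_EFinP.
by rewrite mulr_sumr -sumEFin; apply: eq_bigr => k _; rewrite EFinM.
Qed.

(** Atoms of mass zero are discarded because the bound on the dual potentials divides by the
    [p i]. *)
Lemma finite_support_decomposition {R : realType} {d N : nat} (x : 'I_N -> Rd R d)
    (P : probability (Rd R d) R) : injective x -> P (range x) = 1%E ->
  exists (n : nat) (f : 'I_n -> 'I_N) (p : 'I_n -> R),
  [/\ (n <= N)%N, injective f, forall i, 0 < p i, \sum_i p i = 1 &
      forall A, measurable A -> (P A = \sum_i (p i)%:E * \d_(x (f i)) A)%E].
Proof.
move=> x_inj Px1.
have mx i : measurable [set x i] by exact: measurable_set1_Rd.
have mX : measurable (range x).
  by rewrite -bigcup_imset1; exact: fin_bigcup_measurable.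
pose p i := fine (P [set x i]).
have p0 i : 0 <= p i by exact: fine_ge0.
have PN A : measurable A -> (P A = \sum_i (p i)%:E * \d_(x i) A)%E.
  move=> mA.
  have PC0 : P (A `\` range x) = 0%E.
    apply/eqP; rewrite eq_le measure_ge0 andbT.
    have <- : P (~` range x) = 0%E.
      by rewrite probability_setC// -[X in (_ - X)%E]/(P (range x)) Px1 subee.
    apply: le_measure; rewrite ?inE//.
    - exact: measurableD.
    - exact: measurableC.
  have XE : A `&` range x = \big[setU/set0]_(i < N) (A `&` [set x i]).
    rewrite -bigcup_seq; apply/seteqP; split => [z [Az [i _ xiz]]|z [i _ [Az zi]]].
      by exists i => //=; rewrite mem_index_enum.
    by split => //; exists i.
  have mAx i : measurable (A `&` [set x i]) by exact: measurableI.
  have DI := measureDI P mA mX.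
  have {}DI : P A = P (A `&` range x) by rewrite [LHS]DI [X in (X + _)%E]PC0 add0e.
  rewrite DI XE measure_semi_additive_ord//; last 2 first.
  - apply/trivIsetP => i j _ _ ij; rewrite -subset0 => z [[_ ->] [_ /x_inj ijE]].
    by rewrite ijE eqxx in ij.
  - by rewrite -XE; exact: measurableI.
  apply: eq_bigr => i _; rewrite diracE.
  have [Ax|nAx] := pselect (A (x i)).
    rewrite mem_set// mule1 /p fineK ?fin_num_measure//; congr (P _).
    by apply/seteqP; split => [z []//|z ->].
  rewrite memNset// mule0 -[RHS](measure0 P); congr (P _).
  by rewrite -subset0 => z [Az zx]; apply: nAx; rewrite -zx.
pose I := [set i | 0 < p i]%SET.
have PI A : measurable A -> (P A = \sum_(i < #|I|) (p (enum_val i))%:E * \d_(x (enum_val i)) A)%E.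
  move=> mA; rewrite PN// (bigID (mem I))/= [X in (_ + X)%E]big1 ?adde0; last first.
    move=> i; rewrite inE -leNgt => pi0.
    by have -> : p i = 0 by [apply/eqP; rewrite eq_le pi0 p0]; rewrite mul0e.
  by rewrite big_enum_val.
exists #|I|, enum_val, (p \o enum_val); split => //.
- by rewrite -[leqRHS]card_ord max_card.
- exact: enum_val_inj.
- by move=> i /=; have := enum_valP i; rewrite inE.
- have := PI _ measurableT; rewrite probability_setT.
  under eq_bigr do rewrite diracT mule1.
  by rewrite sumEFin => -[->].
Qed.

(** * Empirical transport cost *)

Section integral_bounds.
Context {R : realType} d (T : measurableType d) (mu : {measure set T -> \bar R}).

(* No measurability: the integral of a nonnegative function is a supremum over
   the simple functions below it. *)
Lemma ge0_le_integral_any (f g : T -> \bar R) :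
  (forall t, 0 <= f t)%E -> (forall t, f t <= g t)%E ->
  (\int[mu]_t f t <= \int[mu]_t g t)%E.
Proof.
move=> f0 fg; have g0 t : (0 <= g t)%E by exact: le_trans (fg t).
rewrite !ge0_integralTE//; apply: ereal_sup_le => _ [h hf <-].
by exists h => //= t; exact: le_trans (hf t) (fg t).
Qed.

Lemma ge0_integralD_le (f g : T -> R) (a b : R) :
  measurable_fun setT f -> (forall t, 0 <= f t) ->
  measurable_fun setT g -> (forall t, 0 <= g t) ->
  (\int[mu]_t (f t)%:E <= a%:E)%E -> (\int[mu]_t (g t)%:E <= b%:E)%E ->
  (\int[mu]_t (f t + g t)%:E <= (a + b)%:E)%E.
Proof.
move=> mf f0 mg g0 fa gb; under eq_integral do rewrite EFinD.
rewrite ge0_integralD//; [by rewrite EFinD leeD| | | |].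
- by move=> t _; rewrite lee_fin.
- exact/measurable_EFinP.
- by move=> t _; rewrite lee_fin.
- exact/measurable_EFinP.
Qed.

Lemma ge0_integral_sum_le n (f : 'I_n -> T -> R) (a : 'I_n -> R) :
  (forall i, measurable_fun setT (f i)) -> (forall i t, 0 <= f i t) ->
  (forall i, \int[mu]_t (f i t)%:E <= (a i)%:E)%E ->
  (\int[mu]_t (\sum_i f i t)%:E <= (\sum_i a i)%:E)%E.
Proof.
move=> mf f0 fa; under eq_integral do rewrite -sumEFin.
rewrite ge0_integral_sum//; last 2 first.
- by move=> i; exact/measurable_EFinP.
- by move=> i t _; rewrite lee_fin.
by rewrite -sumEFin; apply: lee_sum => i _; exact: fa.
Qed.

Lemma ge0_integralZl_le (f : T -> R) (r a : R) : measurable_fun setT f ->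
  (forall t, 0 <= f t) -> 0 <= r -> (\int[mu]_t (f t)%:E <= a%:E)%E ->
  (\int[mu]_t (r * f t)%:E <= (r * a)%:E)%E.
Proof.
move=> mf f0 r0 fa; under eq_integral do rewrite EFinM.
rewrite ge0_integralZl_EFin//.
- by rewrite EFinM lee_wpmul2l// lee_fin.
- by move=> t _; rewrite lee_fin.
- exact/measurable_EFinP.
Qed.

End integral_bounds.

Section semidiscrete_empirical.
Context {R : realType} {d n m : nat}.
Variables (x : 'I_n -> Rd R d) (p : 'I_n -> R) (P Q : probability (Rd R d) R).
Hypothesis x_inj : injective x.
Hypothesis p_gt0 : forall i, 0 < p i.
Hypothesis p_sum1 : \sum_i p i = 1.
Hypothesis PE : forall A, measurable A -> (P A = \sum_i (p i)%:E * \d_(x i) A)%E.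
Variables (D M2 : R).
Hypothesis D_ge0 : 0 <= D.
Hypothesis xD : forall i j, enorm (x i - x j : 'rV[R]_d) <= D.
Hypothesis M2E : (\int[Q]_y (enorm (y : 'rV[R]_d) ^+ 2)%:E = M2%:E)%E.
Hypothesis m_gt0 : (0 < m)%N.
Variables (dO : measure_display) (Omega : measurableType dO).
Variables (Pr : probability Omega R) (Y : 'I_m -> Omega -> Rd R d).
Hypothesis Y_iid : iid_sample Pr Q Y.

Let cost i (y : Rd R d) : R := enorm (x i - y : 'rV[R]_d).

Let norm2_integrable :
  Q.-integrable setT (EFin \o (fun y : Rd R d => enorm (y : 'rV[R]_d) ^+ 2)).
Proof.
apply/integrableP; split.
  by apply/measurable_EFinP; apply: measurable_funX; exact: measurable_enorm.
under eq_integral do rewrite /= ger0_norm ?sqr_ge0//.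
by rewrite M2E ltry.
Qed.

Lemma cost_integrable i : Q.-integrable setT (EFin \o cost i).
Proof.
apply: (@Rintegrable_dominated _ _ _ _ _
  (fun y : Rd R d => enorm (x i : 'rV[R]_d) + 1 + enorm (y : 'rV[R]_d) ^+ 2)).
- exact: measurable_cost.
- by apply: RintegrableD => //; exact: Rintegrable_cst.
- move=> y; rewrite ger0_norm ?enorm_ge0//.
  rewrite (le_trans (enormD _ _))// enormN -addrA lerD2l.
  by have := enorm_ge0 (y : 'rV[R]_d); nra.
Qed.

(** Joint independence, tested with the full space at every other index. *)
Lemma iid_pair k l A B : k != l -> measurable A -> measurable B ->
  Pr (Y k @^-1` A `&` Y l @^-1` B) = (Q A * Q B)%E.
Proof.
move=> kl mA mB; have [Ym [Yl Yi]] := Y_iid.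
pose C j := if j == k then A else if j == l then B else setT.
have mC j : measurable (C j) by rewrite /C; case: ifP => // _; case: ifP.
have := Yi C mC.
have -> : \bigcap_(j in [set: 'I_m]) (Y j @^-1` C j) = Y k @^-1` A `&` Y l @^-1` B.
  apply/seteqP; split => [w H|w [HA HB] j _].
    split; first by have := H k I; rewrite /C eqxx.
    by have := H l I; rewrite /C eqxx eq_sym (negbTE kl).
  by rewrite /C /=; case: eqP => [->//|_]; case: eqP => [->|].
move=> ->; rewrite (bigD1 k)//= (bigD1 l) 1?eq_sym//= big1 ?mule1.
  by rewrite /C eqxx (eq_sym l) (negbTE kl) eqxx !Yl.
move=> j /andP[jk jl]; rewrite /C (negbTE jk) (negbTE jl) preimage_setT.
exact: probability_setT.
Qed.

(* Given the almost optimal pair, the error is controlled by finitely many fixed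
   empirical averages, so that no uniform (chaining) argument is needed. *)
Lemma W1_error_le (e : R) : 0 < e -> exists (w : 'I_n -> Rd R d -> R) (G : Rd R d -> R),
  [/\ forall i, measurable_fun setT (w i), forall i y, 0 <= w i y,
      forall y, \sum_i w i y = 1, measurable_fun setT G &
      forall y y', G y <= G y' + enorm (y - y' : 'rV[R]_d)] /\
  let c y := \sum_i w i y * cost i y in
  let dev (f : Rd R d -> R) v := `|m%:R^-1 * (\sum_k f (Y k v)) - \int[Q]_y f y| in
  forall v, (`|W1 P (empirical (fun k => Y k v)) - W1 P Q| <=
    (dev c v + (dev G v + (D * (\sum_i dev (w i) v) + e)))%:E)%E.
Proof.
(* The error [e'] enters once through the duality gap and once, multiplied by [D], through the
   marginals. *)
move=> e0; pose e' := e / (1 + D).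
have D1 : 0 < 1 + D by rewrite ltr_pwDl.
have e'0 : 0 < e' by rewrite divr_gt0.
have e'E : e' + D * e' = e by rewrite /e'; field; rewrite gt_eqF.
have p0 i : 0 <= p i := ltW (p_gt0 i).
have mcost i : measurable_fun setT (cost i) by exact: measurable_cost.
have cost0 i y : 0 <= cost i y by exact: enorm_ge0.
have [h [w [G [[h0 mw w0 w1] [[mG G0 Gle Glip] [wp Cle]]]]]] :=
  entropic_duality p_gt0 p_sum1 mcost cost0 cost_integrable e'0.
exists w, G; split.
  split => // y y'; apply: Glip => i.
  rewrite /cost (le_trans (enormB_triangle y' _ _))// lerD2l enormBC//.
move=> c dev v.
have w_le1 i y : w i y <= 1.
  by rewrite -(w1 y) (bigD1 i)//= lerDl sumr_ge0.
have mc : measurable_fun setT c.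
  by apply: measurable_sum => i; exact: measurable_funM.
have c0 y : 0 <= c y by apply: sumr_ge0 => i _; rewrite mulr_ge0.
have ic : Q.-integrable setT (EFin \o c).
  apply: Rintegrable_sum => i.
  apply: (Rintegrable_dominated _ (cost_integrable i)).
    exact: measurable_funM.
  by move=> y; rewrite ger0_norm ?mulr_ge0// ler_piMl.
have iG : Q.-integrable setT (EFin \o G).
  have i0 := sum1_ord p_sum1.
  apply: (@Rintegrable_dominated _ _ _ _ _ (fun y => cost i0 y + h i0)) => //.
    by apply: RintegrableD; [exact: cost_integrable|exact: Rintegrable_cst].
  by move=> y; rewrite ger0_norm.
have [nu [nuE nuI]] := empirical_probability (fun k => Y k v) m_gt0.
have nuw i : \int[nu]_y w i y = m%:R^-1 * \sum_k w i (Y k v).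
  by rewrite /Rintegral nuI.
rewrite nuE.
have loQ := W1_weak_duality Q PE x_inj h0 mG G0 Gle.
have upQ := W1_le_approx_kernel_cost Q p0 p_sum1 PE D_ge0 xD mw w0 w1.
have loN := W1_weak_duality nu PE x_inj h0 mG G0 Gle.
have upN := W1_le_approx_kernel_cost nu p0 p_sum1 PE D_ge0 xD mw w0 w1.
rewrite nuI// in loN; rewrite nuI// -/cost in upN.
rewrite -[X in (X <= _)%E]fineK in loQ; last exact: integrable_fin_num.
rewrite -[X in (_ <= X + _)%E]fineK in upQ; last exact: integrable_fin_num.
rewrite -leeBlDr// in loQ; rewrite -leeBlDr// in loN.
rewrite -EFinD in upQ; rewrite -EFinD in upN; rewrite -EFinB in loQ; rewrite -EFinB in loN.
move: loQ upQ loN upN; rewrite -/c.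
(* The finite upper and lower bounds exclude infinite transport costs. *)
case: (W1 P Q) => [a| |]; rewrite ?leye_eq ?leeNy_eq//.
case: (W1 P nu) => [b| |]; rewrite ?leye_eq ?leeNy_eq//.
rewrite !lee_fin => loQ upQ loN upN.
have wle : \sum_i `|\int[nu]_y w i y - p i| <= \sum_i dev (w i) v + e'.
  rewrite -lerBlDl; apply: le_trans wp; rewrite lerBlDl -big_split/=.
  apply: ler_sum => i _; rewrite nuw /dev.
  by rewrite (le_trans _ (ler_normD _ _))// addrA subrK.
have Dwle := ler_wpM2l D_ge0 wle.
have Dwp := ler_wpM2l D_ge0 wp.
rewrite mulrDr in Dwle.
have devs0 : 0 <= D * (\sum_i dev (w i) v).
  by rewrite mulr_ge0// sumr_ge0// => i _; exact: normr_ge0.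
have dc := ler_norm (m%:R^-1 * (\sum_k c (Y k v)) - \int[Q]_y c y).
have dG := ler_norm (- (m%:R^-1 * (\sum_k G (Y k v)) - \int[Q]_y G y)).
rewrite normrN in dG; rewrite -/(dev c v) in dc; rewrite -/(dev G v) in dG.
have dc0 : 0 <= dev c v by exact: normr_ge0.
have dG0 : 0 <= dev G v by exact: normr_ge0.
rewrite -/c in Cle.
rewrite -[X in X - _ <= a]/(\int[Q]_y G y) in loQ.
rewrite -[X in a <= X + _]/(\int[Q]_y c y) in upQ.
by rewrite ler_norml; apply/andP; split; lra.
Qed.

(** Both [c] and [G] stay within [|y| + D] of a constant, so each contributes about
    [2 (sqrt M2 + D) / sqrt m]; the weights together contribute [D sqrt (n / m)]. *)
Lemma W1_L1_error :
  (\int[Pr]_v `|W1 P (empirical (fun k => Y k v)) - W1 P Q| <=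
   ((4 * Num.sqrt M2 + 4 * D + D * Num.sqrt n%:R) / Num.sqrt m%:R)%:E)%E.
Proof.
have i0 := sum1_ord p_sum1.
have n0 : 0 < n%:R :> R by rewrite ltr0n (leq_ltn_trans _ (ltn_ord i0)).
have mR : 0 < m%:R :> R by rewrite ltr0n.
have M2_ge0 : 0 <= M2.
  by rewrite -lee_fin -M2E; apply: integral_ge0 => y _; rewrite lee_fin sqr_ge0.
pose sm : R := Num.sqrt m%:R; pose sn : R := Num.sqrt n%:R; pose a := Num.sqrt M2.
have sm0 : 0 < sm by rewrite sqrtr_gt0.
have sn0 : 0 < sn by rewrite sqrtr_gt0.
have smE : m%:R = sm ^+ 2 by rewrite sqr_sqrtr// ltW.
have snE : n%:R = sn ^+ 2 by rewrite sqr_sqrtr// ltW.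
have aE : M2 = a ^+ 2 by rewrite sqr_sqrtr.
have a0 : 0 <= a by exact: sqrtr_ge0.
rewrite -/sm -/sn -/a.
apply/lee_addgt0Pr => e e0.
have e20 : 0 < e / 2 by rewrite divr_gt0.
(* With scale [t / sm], the mean deviation bound becomes [(V / t + t) / (2 sm)], at most [t / sm]
   since [V = 2 a^2 + 2 D^2 <= t^2]. The summand in [e] keeps [t] positive when [a = D = 0]; over
   [c] and [G] it adds up to [e / 2]. *)
pose t := 2 * (a + D) + e * sm / 4.
have t0 : 0 < t.
  by rewrite ltr_wpDl ?mulr_ge0 ?addr_ge0// divr_gt0// mulr_gt0.
have [w [G [[mw w0 w1 mG Glip] err]]] := W1_error_le e20.
move: err; set c := (fun y => _); set dev := (fun (f : Rd R d -> R) v => _) => /= err.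
have [Ym [Yl _]] := Y_iid.
have mcost i : measurable_fun setT (cost i) by exact: measurable_cost.
have mc : measurable_fun setT c.
  by apply: measurable_sum => i; exact: measurable_funM.
have mdev (f : Rd R d -> R) : measurable_fun setT f -> measurable_fun setT (dev f).
  move=> mf; apply: measurableT_comp => //; apply: measurable_funB => //.
  apply: measurable_funM => //; apply: measurable_sum => k.
  exact: measurableT_comp.
have dev0 f v : 0 <= dev f v by exact: normr_ge0.
have devL1 (f : Rd R d -> R) b V l (mf : measurable_fun setT f) :=
  @sample_mean_L1 _ _ _ Pr _ _ Q _ Y m_gt0 Ym Yl iid_pair f b V l mf.
have lip (f : Rd R d -> R) (b : R) : measurable_fun setT f ->
    (forall y, `|f y - b| <= enorm (y : 'rV[R]_d) + D) ->
    (\int[Pr]_v (dev f v)%:E <= (t / sm)%:E)%E.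
  move=> mf fb; apply: (le_trans (devL1 f b (2 * M2 + 2 * D ^+ 2) (t / sm) mf _ _)).
  - apply: (@le_trans _ _ (\int[Q]_y (2 * enorm (y : 'rV[R]_d) ^+ 2 + 2 * D ^+ 2)%:E)%E).
      apply: ge0_le_integral_any => y; rewrite lee_fin ?sqr_ge0//.
      have fy := fb y; rewrite -(real_normK (num_real (f y - b))).
      set u := enorm _ in fy *; have u0 : 0 <= u by exact: enorm_ge0.
      have : `|f y - b| ^+ 2 <= (u + D) ^+ 2.
        by rewrite lerXn2r ?nnegrE ?addr_ge0.
      by move=> /le_trans; apply; have := sqr_ge0 (u - D); nra.
    apply: ge0_integralD_le => //.
    + apply: measurable_funM => //; apply: measurable_funX; exact: measurable_enorm.
    + by move=> y; rewrite mulr_ge0 ?sqr_ge0.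
    + by move=> y; rewrite mulr_ge0 ?sqr_ge0.
    + apply: ge0_integralZl_le => //; last by rewrite M2E.
        by apply: measurable_funX; exact: measurable_enorm.
      by move=> y; rewrite sqr_ge0.
    + by rewrite integral_cst// [X in (_ * X)%E]probability_setT mule1.
  - by rewrite divr_gt0.
  rewrite lee_fin smE aE.
  have -> : (2 * a ^+ 2 + 2 * D ^+ 2) / (sm ^+ 2 * (t / sm)) =
      (2 * a ^+ 2 + 2 * D ^+ 2) / t / sm by field; rewrite !gt_eqF.
  rewrite -mulrDl -mulrA [sm^-1 * _]mulrC mulrA ler_pM2r ?invr_gt0//.
  rewrite ler_pdivrMr//.
  suff : (2 * a ^+ 2 + 2 * D ^+ 2) / t <= t by lra.
  rewrite ler_pdivrMr//.
  have e4 : 0 <= e * sm / 4 by rewrite ltW// divr_gt0// mulr_gt0.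
  have aD : 0 <= a * D by rewrite mulr_ge0.
  have aD0 : 0 <= a + D by rewrite addr_ge0.
  have := sqr_ge0 a; have := sqr_ge0 D.
  by rewrite /t; nra.
have Ic : (\int[Pr]_v (dev c v)%:E <= (t / sm)%:E)%E.
  (* [c y] is a convex combination of the costs, each within [|y| + D] of the norm of the base
     atom. *)
  apply: (lip c (enorm (x i0 : 'rV[R]_d)) mc) => y.
  have -> : c y - enorm (x i0 : 'rV[R]_d) =
      \sum_i w i y * (cost i y - enorm (x i0 : 'rV[R]_d)).
    under [RHS]eq_bigr do rewrite mulrBr.
    by rewrite sumrB -mulr_suml w1 mul1r.
  rewrite (le_trans (ler_norm_sum _ _ _))//.
  rewrite -[leRHS]mul1r -(w1 y) mulr_suml; apply: ler_sum => i _.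
  rewrite normrM ger0_norm// ler_wpM2l//.
  have h1 : cost i y <=
      enorm (x i - x i0 : 'rV[R]_d) + enorm (x i0 : 'rV[R]_d) + enorm (y : 'rV[R]_d).
    rewrite (le_trans (enormD _ _))// enormN lerD2r.
    by rewrite (le_trans _ (enormD _ _))// subrK.
  have h2 : enorm (x i0 : 'rV[R]_d) <=
      enorm (x i0 - x i : 'rV[R]_d) + (cost i y + enorm (y : 'rV[R]_d)).
    rewrite (le_trans _ (lerD (lexx _) (enormD _ _)))// subrK.
    by rewrite (le_trans _ (enormD _ _))// subrK.
  have := xD i i0; have := xD i0 i => ? ?.
  by rewrite ler_norml; apply/andP; split; lra.
have IG : (\int[Pr]_v (dev G v)%:E <= (t / sm)%:E)%E.
  apply: (lip G (G (0 : 'rV[R]_d)) mG) => y.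
  have := Glip y (0 : 'rV[R]_d); have := Glip (0 : 'rV[R]_d) y.
  rewrite subr0 sub0r enormN => h1 h2.
  apply: (@le_trans _ _ (enorm (y : 'rV[R]_d))); last by rewrite lerDl.
  by rewrite ler_norml lerNl opprB !lerBlDl; apply/andP; split; [exact: h1|exact: h2].
have w_le1 i y : w i y <= 1.
  by rewrite -(w1 y) (bigD1 i)//= lerDl sumr_ge0.
have iw i : Q.-integrable setT (EFin \o w i).
  by apply: (@Rintegrable_bounded _ _ _ _ _ 1) => // y; rewrite ger0_norm.
have Iw : (\int[Pr]_v (\sum_i dev (w i) v)%:E <= (sn / sm)%:E)%E.
  (* Since [0 <= w i <= 1], its second moment is at most [\int w_i dQ], and these sum to 1. The
     total is [(1 / (m l) + n l) / 2], whose two terms this [l] balances at [sn / sm]. *)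
  pose l := (sn * sm)^-1.
  have l0 : 0 < l by rewrite invr_gt0 mulr_gt0.
  apply: (@le_trans _ _ (\sum_i (((\int[Q]_y w i y) / (m%:R * l) + l) / 2))%:E).
    apply: ge0_integral_sum_le => // [i|i]; first exact: mdev.
    apply: (devL1 (w i) 0) => //.
    rewrite fineK; last exact: (integrable_fin_num measurableT (iw i)).
    apply: ge0_le_integral_any => y; rewrite lee_fin subr0 ?sqr_ge0//.
    by rewrite expr2 ler_piMl.
  rewrite lee_fin -mulr_suml big_split/= -mulr_suml -Rintegral_sum//.
  under eq_Rintegral do rewrite w1.
  rewrite Rintegral_cst1 sumr_const card_ord -[l *+ n]mulr_natl /l smE snE.
  rewrite le_eqVlt; apply/orP; left; apply/eqP.
  by field; rewrite !gt_eqF.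
apply: (@le_trans _ _ (\int[Pr]_v (dev c v + (dev G v + (D * (\sum_i dev (w i) v) + e / 2)))%:E)%E).
  by apply: ge0_le_integral_any => // v; exact: abse_ge0.
have msum : measurable_fun setT (fun v => \sum_i dev (w i) v).
  by apply: measurable_sum => i; exact: mdev.
have sum0 v : 0 <= \sum_i dev (w i) v by exact: sumr_ge0.
have Ie : (\int[Pr]_v (e / 2)%:E <= (e / 2)%:E)%E.
  by rewrite integral_cst// [X in (_ * X)%E]probability_setT mule1.
have mDs : measurable_fun setT (fun v => D * \sum_i dev (w i) v).
  exact: measurable_funM.
have Ds0 v : 0 <= D * \sum_i dev (w i) v by exact: mulr_ge0.
have I1 := ge0_integralD_le mDs Ds0 (measurable_cst (e / 2))
  (fun=> ltW e20) (ge0_integralZl_le msum sum0 D_ge0 Iw) Ie.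
have I2 := ge0_integralD_le (mdev _ mG) (dev0 G) (measurable_funD mDs (measurable_cst (e / 2)))
  (fun v => addr_ge0 (Ds0 v) (ltW e20)) IG I1.
have I3 := ge0_integralD_le (mdev _ mc) (dev0 c)
  (measurable_funD (mdev _ mG) (measurable_funD mDs (measurable_cst (e / 2))))
  (fun v => addr_ge0 (dev0 G v) (addr_ge0 (Ds0 v) (ltW e20))) Ic I2.
apply: (le_trans I3); rewrite -EFinD lee_fin /t le_eqVlt; apply/orP; left; apply/eqP.
by field; rewrite gt_eqF.
Qed.

End semidiscrete_empirical.

(** * Diameter bounds and comparison of constants *)

Lemma le_diam {R : realType} (d N : nat) (x : 'I_N -> 'rV[R]_d) i j :
  enorm (x i - x j) <= diam x.
Proof.
apply: (@le_trans _ _ (\big[Num.max/0]_(j < N) enorm (x i - x j))).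
  by rewrite (bigD1 j)//= le_max lexx.
by rewrite /diam [leRHS](bigD1 i)//= le_max lexx.
Qed.

Lemma diam_ge0 {R : realType} (d N : nat) (x : 'I_N -> 'rV[R]_d) : 0 <= diam x.
Proof.
by apply: (big_rec (fun y => 0 <= y)) => // i y _ y0; rewrite le_max y0 orbT.
Qed.

Unset Implicit Arguments.

Theorem theorem2 (R : realType) (d N : nat) (x : 'I_N -> Rd R d)
  (x_inj : injective x)
  (P : probability (Rd R d) R) (P_supp : P (range x) = 1%E)
  (Q : probability (Rd R d) R)
  (Q_mom2 : (\int[Q]_y (enorm (y : 'rV[R]_d) ^+ 2)%:E < +oo)%E)
  (m : nat) (m_gt0 : (0 < m)%N)
  (dO : measure_display) (Omega : measurableType dO) (Pr : probability Omega R)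
  (Y : 'I_m -> Omega -> Rd R d) (Y_iid : iid_sample Pr Q Y) :
  let D := diam (x : 'I_N -> 'rV[R]_d) in
  let M2 := fine (\int[Q]_y (enorm (y : 'rV[R]_d) ^+ 2)%:E) in
  let K := (4 * D + 2 * Num.sqrt M2 + 2 * D) * (ln 2 + Num.sqrt (2 * D + 1)) in
  (\int[Pr]_w `| W1 P (empirical (fun k => Y k w)) - W1 P Q |
     <= ((8 * Num.sqrt (2 * N%:R)) / Num.sqrt m%:R * K)%:E)%E.
Proof.
cbv zeta; set D := diam x; set M2 := fine _; set K := (_ + 2 * D) * _.
have [n [f [p [nN f_inj p0 p1 PE]]]] := finite_support_decomposition x_inj P_supp.
have M2E : (\int[Q]_y (enorm (y : 'rV[R]_d) ^+ 2)%:E = M2%:E)%E.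
  by rewrite /M2 fineK// ge0_fin_numE// integral_ge0// => y _; rewrite lee_fin sqr_ge0.
have D0 : 0 <= D := diam_ge0 _.
have xD i j : enorm (x (f i) - x (f j) : 'rV[R]_d) <= D by exact: le_diam.
have := (@W1_L1_error R d n m (x \o f) p P Q (inj_comp x_inj f_inj)
  p0 p1 PE D M2 D0 xD M2E m_gt0 dO Omega Pr Y Y_iid).
move=> /le_trans; apply.
have mR : 0 < Num.sqrt m%:R :> R by rewrite sqrtr_gt0 ltr0n.
rewrite lee_fin mulrAC ler_pM2r ?invr_gt0//.
have n1 : (0 < n)%N := leq_ltn_trans (leq0n _) (ltn_ord (sum1_ord p1)).
have s1 : 1 <= Num.sqrt N%:R :> R.
  by rewrite -[leLHS]sqrtr1 ler_wsqrtr// ler1n (leq_trans n1).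
have ns : Num.sqrt n%:R <= Num.sqrt N%:R :> R by rewrite ler_wsqrtr// ler_nat.
have N2 : Num.sqrt N%:R <= Num.sqrt (2 * N%:R) :> R.
  by rewrite ler_wsqrtr//; have : 0 <= N%:R :> R by []; lra.
(* The logarithmic factor of [K] is at least 1, so the sharper bound without it is enough. *)
have L1 : 1 <= ln 2 + Num.sqrt (2 * D + 1).
  have l2 : 0 <= ln 2 :> R by rewrite ln_ge0// ler1n.
  have : 1 <= Num.sqrt (2 * D + 1) by rewrite -[leLHS]sqrtr1 ler_wsqrtr//; lra.
  lra.
have a0 : 0 <= Num.sqrt M2 := sqrtr_ge0 _.
have DS := ler_wpM2l D0 ns.
(* As [sqrt N >= 1] and [sqrt n <= sqrt N], each of the terms in [sqrt M2], [D] and [D sqrt n] is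
   absorbed. *)
apply: (@le_trans _ _ (8 * Num.sqrt N%:R * (4 * D + 2 * Num.sqrt M2 + 2 * D))).
  by nra.
have K0 : 0 <= 4 * D + 2 * Num.sqrt M2 + 2 * D by lra.
apply: ler_pM => //.
  by rewrite ler_wpM2l.
by rewrite /K -[leLHS]mulr1 ler_wpM2l.
Qed.
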